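(* Let $k$ be an infinite field and $R$ an overring of $k$ such that $R$ is finite-dimensional as a left $k$-vector-space, $k$ has central image in $R/J(R)$ and centralizes $\operatorname{socle}(R)$, and $R/J(R)$ is a direct product of full matrix rings over $k$ (this last condition being automatic if $k$ is algebraically closed). Let $G$ be the bipartite graph whose left vertex-set consists of symbols $f_{\mathrm{left}}$ for all minimal central idempotents $f\in R/J(R)$ such that $f\operatorname{socle}(R)\neq\{0\}$, whose right vertex-set consists of symbols $e_{\mathrm{right}}$ for all minimal central idempotents $e\in R/J(R)$ such that $\operatorname{socle}(R)\,e\neq\{0\}$, and whose edge-set is $\{(f_{\mathrm{left}},e_{\mathrm{right}})\mid f\operatorname{socle}(R)\,e\neq\{0\}\}$. Then for any faithful left $R$-module $M$ such that no proper submodule or proper homomorphic image of $M$ is faithful, we have $$\operatorname{length}(M/J(R)M)\ +\ \operatorname{length}(\operatorname{socle}(M))\ \leq\ \operatorname{length}(\operatorname{socle}(R))\ +\ \chi(G),$$ where the two lengths on the left are as left $R$-modules, while the length on the right is as an $(R,R)$-bimodule.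
   Context: Rings are associative and unital, not assumed commutative. $J(R)$ denotes the Jacobson radical of $R$. The socle of a module $M$ is the sum of its simple submodules. The socle of a ring $R$, $\operatorname{socle}(R)$, is the sum of all minimal nonzero two-sided ideals of $R$; for $R$ left or right Artinian it is the intersection of the left and right socles of $R$. It is annihilated by $J(R)$ on both sides, so it is regarded as a bimodule over $R/J(R)$. A minimal central idempotent is a minimal nonzero element among the central idempotents, where $e\le f$ means $e=ef=fe$. The Euler characteristic $\chi(G)$ of a finite graph $G$ is the number of vertices minus the number of edges (an integer, possibly negative). A proper homomorphic image of $M$ is a quotient $M/N$ with $N\neq 0$. *)

(* Defs.v *)
From HB Require Import structures.
From mathcomp Require Import all_boot all_order all_algebra.
From mathcomp Require Import boolp classical_sets functions cardinality.

Set Implicit Arguments.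
Unset Strict Implicit.
Unset Printing Implicit Defensive.

Import GRing.Theory.

Local Open Scope ring_scope.
Local Open Scope quotient_scope.

Definition sums_of (V : nmodType) (A : set V) : {pred V} :=
  fun x => `[< exists s : seq V,
                 (forall y, y \in s -> A y) /\ x = \sum_(y <- s) y >].

Lemma sums_of_closed (R : pzRingType) (V : lmodType R) (A : set V) :
  (forall (r : R) x, A x -> A (r *: x)) -> submod_closed (sums_of A).
Proof.
move=> AZ; split=> [|r x y /asboolP[s [As ->]] /asboolP[t [At ->]]].
  by apply/asboolP; exists [::]; split; rewrite ?big_nil.
apply/asboolP; exists ([seq r *: z | z <- s] ++ t); split.
  move=> z; rewrite mem_cat => /orP[/mapP[w ws ->]|]; last exact: At.
  exact/AZ/As.
by rewrite big_cat big_map scaler_sumr.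
Qed.

(* n is the supremum of the lengths of the strictly increasing chains
   c 0 < c 1 < ... < c m of members of the family L of subsets of T (for
   submodules: the length).  No n qualifies if these lengths are unbounded. *)
Definition chain (T : Type) (L : set {pred T}) (c : nat -> {pred T})
    (m : nat) : Prop :=
  (forall i, (i <= m)%N -> L (c i)) /\
  (forall i, (i < m)%N ->
     {subset c i <= c i.+1} /\ exists2 x, x \in c i.+1 & x \notin c i).

Definition is_length (T : Type) (L : set {pred T}) (n : nat) : Prop :=
  (exists c, chain L c n) /\ (forall c m, chain L c m -> (m <= n)%N).

Section Submodule.
Variables (R : pzRingType) (V : lmodType R) (U : submodClosed V).

Record submod := Submod { submod_val :> V; _ : submod_val \in U }.

HB.instance Definition _ := [isSub for submod_val].
HB.instance Definition _ := [Choice of submod by <:].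
HB.instance Definition _ := [SubChoice_isSubLmodule of submod by <:].

Definition submod_pred : {pred V} := fun x => x \in U.

Fact submod_pred_zmod : zmod_closed submod_pred.
Proof. exact/GRing.submod_closedB/submodClosedP. Qed.
HB.instance Definition _ := GRing.isZmodClosed.Build V submod_pred
  submod_pred_zmod.

Definition quotmod : Type := Quotient.quot submod_pred.
HB.instance Definition _ := GRing.Zmodule.on quotmod.

Definition quotmod_pi (x : V) : quotmod := \pi_(Quotient.quot submod_pred) x.

Definition quotmod_scale (r : R) (x : quotmod) : quotmod :=
  quotmod_pi (r *: repr (x : Quotient.quot submod_pred)).

Fact quotmod_piP x y : (quotmod_pi x = quotmod_pi y) <-> (x - y \in U).
Proof.
split=> [/eqP|xy]; first by rewrite -Quotient.idealrBE.
by apply/eqP; rewrite -Quotient.idealrBE.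
Qed.

Fact quotmod_piK (x : quotmod) :
  quotmod_pi (repr (x : Quotient.quot submod_pred)) = x.
Proof. exact: reprK. Qed.

Fact quotmod_piD x y : quotmod_pi (x + y) = quotmod_pi x + quotmod_pi y.
Proof. exact: (raddfD (\pi_(Quotient.quot submod_pred))). Qed.

Fact quotmod_piZ r x : quotmod_pi (r *: x) = quotmod_scale r (quotmod_pi x).
Proof.
apply/quotmod_piP; rewrite -scalerBr.
by apply: (rpredZ (s := U)); apply/quotmod_piP; rewrite quotmod_piK.
Qed.

Fact quotmod_scaleA a b v :
  quotmod_scale a (quotmod_scale b v) = quotmod_scale (a * b) v.
Proof. by rewrite -[v]quotmod_piK -!quotmod_piZ scalerA. Qed.
Fact quotmod_scale1 : left_id 1 quotmod_scale.
Proof. by move=> v; rewrite -[v]quotmod_piK -!quotmod_piZ scale1r. Qed.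
Fact quotmod_scaleDr : right_distributive quotmod_scale +%R.
Proof.
move=> a u v; rewrite -[v]quotmod_piK -[u]quotmod_piK.
by rewrite -quotmod_piD -!quotmod_piZ -quotmod_piD scalerDr.
Qed.
Fact quotmod_scaleDl v : {morph quotmod_scale^~ v : a b / a + b}.
Proof.
by move=> a b /=; rewrite -[v]quotmod_piK -!quotmod_piZ -quotmod_piD scalerDl.
Qed.
HB.instance Definition _ := GRing.Zmodule_isLmodule.Build R quotmod
  quotmod_scaleA quotmod_scale1 quotmod_scaleDr quotmod_scaleDl.

End Submodule.

Section Modules.
Variable R : pzRingType.

Definition faithful (V : lmodType R) : Prop :=
  forall r : R, (forall x : V, r *: x = 0) -> r = 0.

Definition simple_module (V : lmodType R) : Prop :=
  (exists x : V, x != 0) /\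
  forall U : submodClosed V,
    (forall x, x \in U -> x = 0) \/ (forall x, x \in U).

Definition module_length (V : lmodType R) (n : nat) : Prop :=
  is_length [set U : {pred V} | submod_closed U] n.

Variable V : lmodType R.

Definition socle : {pred V} :=
  sums_of [set x : V |
    exists2 U : submodClosed V, simple_module (submod U) & x \in U].

Fact socle_closed : submod_closed socle.
Proof. by apply: sums_of_closed => r x [U sU xU]; exists U => //; apply: rpredZ. Qed.
HB.instance Definition _ := GRing.isSubmodClosed.Build R V socle
  (GRing.submod_closed_semi socle_closed).

End Modules.

Section TwoSidedIdeals.
Variable R : pzRingType.

Definition ideal_closed (I : {pred R}) : Prop :=
  zmod_closed I /\
  forall r x, x \in I -> r * x \in I /\ x * r \in I.

Definition minimal_ideal (I : {pred R}) : Prop :=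
  [/\ ideal_closed I,
      exists2 x, x \in I & x != 0 &
      forall K : {pred R}, ideal_closed K -> {subset K <= I} ->
        (exists2 x, x \in K & x != 0) -> {subset I <= K}].

Definition ring_socle : {pred R} :=
  sums_of [set x : R | exists2 I : {pred R}, minimal_ideal I & x \in I].

(* The (R,R)-subbimodules of a two-sided ideal I are the two-sided ideals of R
   contained in I. *)
Definition bimodule_length (I : {pred R}) (n : nat) : Prop :=
  is_length [set K : {pred R} | ideal_closed K /\ {subset K <= I}] n.

End TwoSidedIdeals.

Section JacobsonRadical.
Variable R : pzRingType.

(* Left ideals are submodules of the regular left module R^o. *)
Definition maximal_left_ideal (I : submodClosed R^o) : Prop :=
  1 \notin I /\
  forall K : submodClosed R^o, {subset I <= K} ->
    {subset K <= I} \/ (forall x, x \in K).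

Definition jacobson : {pred R} :=
  fun x => `[< forall I : submodClosed R^o, maximal_left_ideal I -> x \in I >].

Section Transporter.
Variables (I : submodClosed R^o) (r : R).
Definition transporter : {pred R^o} := fun x => (x : R) * r \in I.
Fact in_transporter x : (x \in transporter) = ((x : R) * r \in I).
Proof. by []. Qed.
Fact transporter_closed : submod_closed transporter.
Proof.
split=> [|a x y]; rewrite !in_transporter ?mul0r; first exact: (rpred0 I).
move=> xI yI; rewrite mulrDl -mulrA; apply: (rpredD (S := I)) => //.
exact: (rpredZ (s := I) a).
Qed.
HB.instance Definition _ := GRing.isSubmodClosed.Build R R^o transporter
  (GRing.submod_closed_semi transporter_closed).
End Transporter.

Section Translate.
Variables (I K : submodClosed R^o) (r : R).
Definition translate : {pred R^o} :=
  fun x => `[< exists2 y, y \in I & exists2 z, z \in K &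
                 x = y + (z : R) * r :> R >].
Fact translate_closed : submod_closed translate.
Proof.
split=> [|a _ _ /asboolP[y yI [z zK ->]] /asboolP[y' yI' [z' zK' ->]]].
  apply/asboolP; exists 0; rewrite ?rpred0 //.
  by exists 0; rewrite ?rpred0 // mul0r addr0.
apply/asboolP; exists (a *: y + y'); first by rewrite rpredD ?rpredZ.
exists (a *: z + z'); first by rewrite rpredD ?rpredZ.
rewrite scalerDr mulrDl addrACA; congr (_ + (_ + _)).
exact: mulrA.
Qed.
HB.instance Definition _ := GRing.isSubmodClosed.Build R R^o translate
  (GRing.submod_closed_semi translate_closed).
End Translate.

Fact jacobson_closed : ideal_closed jacobson.
Proof.
split.
  split=> [|x y /asboolP xJ /asboolP yJ].
    by apply/asboolP => I _; apply: rpred0.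
  apply/asboolP => I mI; have [_ IB] := GRing.submod_closedB (submodClosedP I).
  by apply: IB; [apply: xJ|apply: yJ].
move=> r x /asboolP xJ; split; apply/asboolP => I mI.
  exact: (rpredZ (s := I) r (xJ I mI)).
have [rI|rNI] := boolP ((r : R^o) \in I).
  exact: (rpredZ (s := I) x rI).
apply: (xJ (transporter I r)); split.
  by rewrite in_transporter mul1r.
move=> K sub; have [_ /(_ (translate I K r))] := mI; case.
- move=> y yI; apply/asboolP; exists y => //; exists 0; rewrite ?rpred0 //.
  by rewrite mul0r addr0.
- move=> sKI; left=> z zK; rewrite in_transporter; apply: sKI.
  by apply/asboolP; exists 0; rewrite ?rpred0 //; exists z; rewrite ?add0r.
move=> all; right=> x'; have /asboolP[y yI [z zK e]] := all ((x' : R) * r).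
have zx : (x' : R) - z \in transporter I r.
  by rewrite in_transporter mulrBl e addrK.
rewrite -[x'](subrK (z : R^o)) rpredD //; exact: sub.
Qed.
HB.instance Definition _ := GRing.isZmodClosed.Build R jacobson
  jacobson_closed.1.

Definition jacquot : Type := Quotient.quot jacobson.
HB.instance Definition _ := GRing.Zmodule.on jacquot.

Definition jacquot_pi (x : R) : jacquot := \pi_(Quotient.quot jacobson) x.
Definition jacquot_repr (x : jacquot) : R :=
  repr (x : Quotient.quot jacobson).

Definition jacquot_mul (x y : jacquot) : jacquot :=
  jacquot_pi (jacquot_repr x * jacquot_repr y).

Fact jacquot_piP x y : (jacquot_pi x = jacquot_pi y) <-> (x - y \in jacobson).
Proof.
split=> [/eqP|xy]; first by rewrite -Quotient.idealrBE.
by apply/eqP; rewrite -Quotient.idealrBE.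
Qed.

Fact jacquot_reprK x : jacquot_pi (jacquot_repr x) = x.
Proof. exact: reprK. Qed.

Fact jacquot_piD x y : jacquot_pi (x + y) = jacquot_pi x + jacquot_pi y.
Proof. exact: (raddfD (\pi_(Quotient.quot jacobson))). Qed.

Fact jacquot_piB x y : jacquot_pi (x - y) = jacquot_pi x - jacquot_pi y.
Proof. exact: (raddfB (\pi_(Quotient.quot jacobson))). Qed.

Fact jacquot_piM x y :
  jacquot_pi (x * y) = jacquot_mul (jacquot_pi x) (jacquot_pi y).
Proof.
rewrite /jacquot_mul; set x' := jacquot_repr _; set y' := jacquot_repr _.
apply/jacquot_piP; have -> : x * y - x' * y' = x * (y - y') + (x - x') * y'.
  by rewrite mulrBr mulrBl addrA subrK.
apply: rpredD.
  apply: (jacobson_closed.2 x _ _).1.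
  by apply/jacquot_piP; rewrite jacquot_reprK.
apply: (jacobson_closed.2 y' _ _).2.
by apply/jacquot_piP; rewrite jacquot_reprK.
Qed.

Fact jacquot_mulA : associative jacquot_mul.
Proof.
move=> x y z; rewrite -[x]jacquot_reprK -[y]jacquot_reprK -[z]jacquot_reprK.
by rewrite -!jacquot_piM mulrA.
Qed.
Fact jacquot_mul1 : left_id (jacquot_pi 1) jacquot_mul.
Proof. by move=> x; rewrite -[x]jacquot_reprK -jacquot_piM mul1r. Qed.
Fact jacquot_1mul : right_id (jacquot_pi 1) jacquot_mul.
Proof. by move=> x; rewrite -[x]jacquot_reprK -jacquot_piM mulr1. Qed.
Fact jacquot_mulDl : left_distributive jacquot_mul +%R.
Proof.
move=> x y z; rewrite -[x]jacquot_reprK -[y]jacquot_reprK -[z]jacquot_reprK.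
by rewrite -jacquot_piD -!jacquot_piM -jacquot_piD mulrDl.
Qed.
Fact jacquot_mulDr : right_distributive jacquot_mul +%R.
Proof.
move=> x y z; rewrite -[x]jacquot_reprK -[y]jacquot_reprK -[z]jacquot_reprK.
by rewrite -jacquot_piD -!jacquot_piM -jacquot_piD mulrDr.
Qed.
HB.instance Definition _ := GRing.Zmodule_isPzRing.Build jacquot
  jacquot_mulA jacquot_mul1 jacquot_1mul jacquot_mulDl jacquot_mulDr.

HB.instance Definition _ := GRing.isZmodMorphism.Build R jacquot jacquot_pi
  jacquot_piB.
Fact jacquot_pi_monoid : monoid_morphism jacquot_pi.
Proof. by split=> // x y; rewrite jacquot_piM. Qed.
HB.instance Definition _ := GRing.isMonoidMorphism.Build R jacquot jacquot_pi
  jacquot_pi_monoid.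

Definition jacobson_smul (V : lmodType R) : {pred V} :=
  sums_of [set x : V | exists2 j, j \in jacobson & exists y : V, x = j *: y].

Fact jacobson_smul_closed (V : lmodType R) : submod_closed (@jacobson_smul V).
Proof.
apply: sums_of_closed => r x [j jJ [y ->]]; exists (r * j).
  exact: (jacobson_closed.2 r _ jJ).1.
by exists y; rewrite scalerA.
Qed.
HB.instance Definition _ (V : lmodType R) :=
  GRing.isSubmodClosed.Build R V (@jacobson_smul V)
    (GRing.submod_closed_semi (@jacobson_smul_closed V)).

End JacobsonRadical.

Section CentralIdempotents.
Variable A : pzRingType.

Definition central_idempotent (e : A) : Prop :=
  e * e = e /\ forall x, e * x = x * e.

Definition idempotent_le (e f : A) : Prop := e = e * f /\ e = f * e.

Definition minimal_central_idempotent (e : A) : Prop :=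
  [/\ central_idempotent e, e != 0 &
      forall f, central_idempotent f -> f != 0 -> idempotent_le f e -> f = e].

End CentralIdempotents.

(* An edge is an ordered pair of vertices; each edge must be listed in only
   one of its two orientations. *)
Record graph (T : Type) := Graph { vertices : set T; edges : set (T * T) }.

(* Holds for at most one integer x, and for one exactly when G is finite. *)
Definition euler_characteristic (T : Type) (G : graph T) (x : int) : Prop :=
  exists v e : nat,
    [/\ (vertices G #= `I_v)%card, (edges G #= `I_e)%card & x = v%:Z - e%:Z].

Section SocleGraph.
Variable R : pzRingType.
Local Notation Rbar := (jacquot R).

(* f x e, for x in socle(R) and f, e in R/J(R); independent of the choice of
   representatives when J(R) socle(R) = socle(R) J(R) = 0. *)
Definition socle_lact (f : Rbar) (x : R) : R := jacquot_repr f * x.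
Definition socle_ract (x : R) (e : Rbar) : R := x * jacquot_repr e.

(* inl f and inr e are the symbols f_left and e_right. *)
Definition socle_graph : graph (Rbar + Rbar) :=
  Graph
    ([set inl f | f in [set f : Rbar | minimal_central_idempotent f /\
        exists2 x, x \in @ring_socle R & socle_lact f x != 0]] `|`
     [set inr e | e in [set e : Rbar | minimal_central_idempotent e /\
        exists2 x, x \in @ring_socle R & socle_ract x e != 0]])%classic
    [set p : (Rbar + Rbar) * (Rbar + Rbar) | exists f e : Rbar,
        [/\ minimal_central_idempotent f, minimal_central_idempotent e,
            exists2 x, x \in @ring_socle R &
              socle_ract (socle_lact f x) e != 0 &
            p = (inl f, inr e)]]%classic.

End SocleGraph.

Definition finite_dim_left (k : fieldType) (R : pzRingType) (iota : k -> R) :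
    Prop :=
  exists (n : nat) (b : 'I_n -> R),
    forall x, exists c : 'I_n -> k, x = \sum_(i < n) iota (c i) * b i.

(* A is isomorphic, compatibly with the map iota : k -> A, to a finite direct
   product of full matrix rings M_m(k), m > 0; the psi i are the components of
   the isomorphism. *)
Definition product_of_matrix_rings (k : fieldType) (A : pzRingType)
    (iota : k -> A) : Prop :=
  exists (s : nat) (m : 'I_s -> nat)
         (psi : forall i : 'I_s, {rmorphism A -> 'M[k]_((m i).+1)}),
    (forall (i : 'I_s) (c : k), psi i (iota c) = c%:M) /\
    bijective (fun (x : A) (i : 'I_s) => psi i x).

(* Main.v *)
Require Import Defs.
From HB Require Import structures.
From mathcomp Require Import all_boot all_order all_algebra.
From mathcomp Require Import boolp classical_sets functions cardinality.

Set Implicit Arguments.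
Unset Strict Implicit.
Unset Printing Implicit Defensive.

Import GRing.Theory.

Local Open Scope ring_scope.

(** The socle S of R is killed by J on both sides, so it acts as maps
    M / J M -> ann_M(J), and a module is faithful as soon as no nonzero element of S
    kills it.  Cut everything with one primitive idempotent e_i per matrix block of
    R / J: put A_j = e_j (M / J M), B_i = e_i ann_M(J), and let
    D_ij <= Hom(A_j, B_i) be the image of e_i S e_j.  Minimality of M says that
    every hyperplane of A_j is the kernel, and every line of B_i the image, of a
    rank one element of some D_ij.  Length(M / J M) and length(socle M) are at most
    the sums of the dim A_j and dim B_i, while length(S) is at least the sum of the
    dim D_ij, so the bound reduces to linear algebra over the infinite field k:
    sum (dim A_j - 1) + sum (dim B_i - 1) <= sum (dim D_ij - 1), the last sum being
    over the edges of G.  Over an algebraically closed field, R / J is a product of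
    matrix rings by Burnside's theorem on irreducible matrix algebras. *)

(** [k] is central only modulo J and on the socle, so R need not be a [k]-algebra and its elements
    need not act [k]-linearly on M. Only linear actions are used: socle elements commute with [k],
    and on M / J M and ann_M(J) the ring acts through R / J. For the same reason the e_i can be
    arbitrary representatives in R: they are only applied where J acts as zero, so idempotents need
    not be lifted. Both minimality conditions enter through submodules built from a single vector:
    the largest submodule inside a hyperplane of A_j is proper, so a nonzero socle element kills it;
    the submodule generated by a line of B_i is nonzero, so a nonzero socle element maps M into it.
    The obstacle in the linear algebra is that different vectors at one vertex may use different
    edges. A generic vector over an infinite field defeats finitely many failures at once, so each
    vertex can be assigned one edge. The defect 1 in a + b - 1 <= dim D comes from the scaling
    shared by the two factors of a pure tensor; collected over vertices and edges, these ones make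
    up the Euler characteristic. *)

(** * Subspaces and generic members of pencils over an infinite field *)

(** A subspace inside [P] of maximal dimension must be all of [P]. This gives a dimension to sets
    that are described by existential conditions. *)
Lemma closed_vspace (k : fieldType) (V : vectType k) (P : {pred V}) :
  submod_closed P -> exists U : {vspace V}, U =i P.
Proof.
move=> [P0 PL].
pose Q n := `[< exists U : {vspace V}, {subset U <= P} /\ \dim U = n >].
have exQ : exists n, Q n.
  exists 0%N; apply/asboolP; exists 0%VS; split; last by rewrite dimv0.
  by move=> x; rewrite memv0 => /eqP->.
have ubQ n : Q n -> (n <= \dim {: V})%N.
  by move=> /asboolP[U [_ <-]]; apply/dimvS/subvf.
case: (ex_maxnP exQ ubQ) => n /asboolP[U [sUP dU]] maxn.
exists U => x; apply/idP/idP => [/sUP //|Px].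
case: (boolP (x \in U)) => // xNU.
have /maxn : Q (\dim (U + <[x]>)%VS).
  apply/asboolP; exists (U + <[x]>)%VS; split=> //.
  move=> _ /memv_addP[u uU [_ /vlineP[c ->] ->]].
  by rewrite addrC; apply: PL => //; apply: sUP.
rewrite -dU leqNgt; case/negP.
rewrite ltn_neqAle dimvS ?addvSl // andbT.
have := dimv_leqif_sup (addvSl U <[x]>%VS) => -[_ ->].
apply/negP => /subvP/(_ x)/(_ _) h.
by move: xNU; rewrite h // memvE addvSr.
Qed.

Lemma roots_finite (k : fieldType) (p : {poly k}) :
  p != 0 -> exists s : seq k, forall x, root p x -> x \in s.
Proof.
move: {2}(size p) (leqnn (size p)) => n.
elim: n p => [p|n IHn p sp p0].
  by rewrite leqn0 size_poly_eq0 => ->.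
case: (pselect (exists x, root p x)) => [[x /factor_theorem[q pE]]|nr].
  have q0 : q != 0 by apply: contraNneq p0 => q0; rewrite pE q0 mul0r.
  have [|s sP] := IHn q _ q0.
    by move: sp; rewrite pE size_Mmonic ?monicXsubC // size_XsubC addn2.
  exists (x :: s) => y; rewrite pE rootM root_XsubC inE.
  by move=> /orP[/sP ->|->] //; rewrite orbT.
by exists [::] => x px; case: nr; exists x.
Qed.

Lemma unitmx_perturb (k : fieldType) m (C : 'M[k]_m) :
  exists s : seq k, forall t, t \notin s -> 1%:M + t *: C \in unitmx.
Proof.
pose P : 'M[{poly k}]_m := 1%:M + 'X *: map_mx polyC C.
have PE t : (\det P).[t] = \det (1%:M + t *: C).
  rewrite -horner_evalE -det_map_mx; congr (\det _).
  apply/matrixP => i j; rewrite !mxE /= /horner_eval hornerD hornerM hornerX.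
  by rewrite hornerC -[1 *+ _]/((1 : {poly k}) *+ (i == j)) hornerMn hornerC.
have P0 : \det P != 0.
  apply/eqP => d0; have := PE 0; rewrite d0 scale0r addr0 det1 horner0.
  by move/eqP; rewrite eq_sym oner_eq0.
have [s sP] := roots_finite P0; exists s => t tNs.
rewrite unitmxE unitfE -PE; apply: contraNneq tNs => e.
by apply: sP; rewrite /root e.
Qed.

(* Composing with a left inverse of f modulo D turns the pencil f + t g into
   1 + t C, whose determinant is a polynomial in t with value 1 at t = 0. *)
Lemma pencil_injective (k : fieldType) m (W : vectType k) (D : {vspace W})
    (f g : 'rV[k]_m -> W) :
  linear f -> linear g -> (forall x, f x \in D -> x = 0) ->
  exists s : seq k, forall t, t \notin s ->
    forall x, f x + t *: g x \in D -> x = 0.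
Proof.
move=> fL gL finj.
pose fT : {linear 'rV[k]_m -> W} := HB.pack f (GRing.isLinear.Build _ _ _ _ f fL).
pose gT : {linear 'rV[k]_m -> W} := HB.pack g (GRing.isLinear.Build _ _ _ _ g gL).
(* The kernel of [pr] is exactly [D], so [pr] serves as the quotient map modulo [D]. *)
pose pr := (\1 - projv D)%VF.
have prD x : (pr x == 0) = (x \in D).
  rewrite /pr add_lfunE opp_lfunE id_lfunE subr_eq0; apply/eqP/idP => [->|/projv_id -> //].
  exact: memv_proj.
pose F := (pr \o linfun fT)%VF; pose G := (pr \o linfun gT)%VF.
have FE x : F x = pr (f x) by rewrite /F comp_lfunE (lfunE fT).
have GE x : G x = pr (g x) by rewrite /G comp_lfunE (lfunE gT).
have kF : lker F == 0%VS.
  rewrite -subv0; apply/subvP => x; rewrite memv_ker memv0 FE prD.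
  by move=> /finj ->.
pose C := lin1_mx ((F^-1 \o G)%VF : {linear _ -> _}).
have [s sP] := unitmx_perturb C; exists s => t /sP tU x.
rewrite -prD raddfD /= linearZ /= -FE -GE => /eqP e.
have : x *m (1%:M + t *: C) = 0.
  rewrite mulmxDr mulmx1 -scalemxAr mul_rV_lin1 /= comp_lfunE.
  by rewrite -{1}[x](lker0_lfunK kF) -linearZ -linearD e linear0.
by move/(congr1 (mulmx^~ (invmx (1%:M + t *: C)))); rewrite mulmxK // mul0mx.
Qed.

Lemma mulmx_trl_linear (k : fieldType) a b (p : 'rV[k]_a) :
  linear (fun q : 'rV[k]_b => p^T *m q).
Proof. by move=> c q q'; rewrite mulmxDr scalemxAr. Qed.

(* Each condition "some q <> 0 has p^T q in D i" fails for generic p as soon as it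
   fails for one p, so if every i failed somewhere, a generic p would violate the
   hypothesis. *)
Lemma uniform_vertex (k : fieldType) (fresh : forall s : seq k, exists t, t \notin s)
    a (I : finType) (b : I -> nat) (D : forall i, {vspace 'M[k]_(a, b i)}) :
  (0 < a)%N ->
  (forall p : 'rV_a, p != 0 ->
     exists i, exists2 q : 'rV_(b i), q != 0 & p^T *m q \in D i) ->
  exists i, forall p : 'rV_a, p != 0 ->
    exists2 q : 'rV_(b i), q != 0 & p^T *m q \in D i.
Proof.
move=> a0 H; apply: contrapT => nH.
pose bad i (p : 'rV[k]_a) := forall q : 'rV_(b i), p^T *m q \in D i -> q = 0.
have {nH} badE i : exists p, bad i p.
  apply: contrapT => nb; apply: nH; exists i => p p0.
  apply: contrapT => nq; apply: nb; exists p => q qD.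
  by apply/eqP; apply: contrapT => /negP q0; apply: nq; exists q.
have badL (r : seq I) : exists p, forall i, i \in r -> bad i p.
  elim: r => [|i r [p pP]]; first by exists 0.
  have [pi piP] := badE i.
  have [s sP] : exists s : seq k, forall t, t \notin s ->
      forall l, l \in r -> bad l (p + t *: pi).
    elim: r pP => [|l r IHr] pP; first by exists [::].
    have [|s sP] := IHr; first by move=> j jr; apply: pP; rewrite inE jr orbT.
    have pl : bad l p by apply: pP; rewrite mem_head.
    have [s' sP'] := pencil_injective (mulmx_trl_linear p)
      (mulmx_trl_linear (b := b l) pi) pl.
    exists (s ++ s') => t; rewrite mem_cat negb_or => /andP[ts ts'] j.
    rewrite inE => /orP[/eqP->|]; last exact: sP.
    move=> q; rewrite linearD linearZ /= mulmxDl -scalemxAl.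
    exact: sP'.
  (* For the new index the pencil starts at [pi]: since [p + t *: pi] is t times [pi + t^-1 *: p],
     the values to avoid are 0 and the inverses of those in [s']. *)
  have [s' sP'] := pencil_injective (mulmx_trl_linear pi)
      (mulmx_trl_linear (b := b i) p) piP.
  have [t] := fresh (0 :: s ++ [seq x^-1 | x <- s']).
  rewrite inE mem_cat !negb_or => /and3P[t0 ts ts'].
  exists (p + t *: pi) => l; rewrite inE => /orP[/eqP->|]; last exact: sP.
  move=> q qD; apply: (sP' t^-1).
    by apply: contra ts' => h; apply/mapP; exists t^-1; rewrite ?invrK.
  have := memvZ t^-1 qD; rewrite linearD linearZ /= mulmxDl -scalemxAl scalerDr.
  by rewrite scalerA mulVf // scale1r addrC.
have [p pP] := badL (enum I).
have [] := H p.
  (* The generic [p] is nonzero: if 0 were bad for every index, all the spaces ['rV_(b i)] would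
     vanish, whereas [H] at the constant row yields a nonzero [q]. *)
  have p1 : (const_mx 1 : 'rV[k]_a) != 0.
    case: a a0 {H D bad badE badL p pP} => // a _.
    by apply/rowV0Pn; exists (const_mx 1); [exact: submx_refl|];
       apply/eqP => /matrixP/(_ 0 0); rewrite !mxE => /eqP; rewrite oner_eq0.
  have [i [q q0 _]] := H _ p1.
  apply: contraNneq q0 => p0; apply/eqP/(pP i); first by rewrite mem_enum.
  by rewrite p0 trmx0 mul0mx mem0v.
by move=> i [q q0 /pP q00]; rewrite q00 ?mem_enum ?eqxx in q0.
Qed.

(** * Dimension bounds for matrix spaces rich in pure tensors, and the count over edges *)

Lemma dim_ge_independent (k : fieldType) (V : vectType k) (U : {vspace V}) n
    (v : 'I_n -> V) :
  (forall i, v i \in U) ->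
  (forall c : 'I_n -> k, \sum_i c i *: v i = 0 -> forall i, c i = 0) ->
  (n <= \dim U)%N.
Proof.
move=> vU ind; pose X := [tuple v i | i < n].
have vE (i : 'I_n) : X`_i = v i by rewrite -tnth_nth tnth_mktuple.
have /eqP fX : free X.
  apply/freeP => c e; apply: ind; rewrite -[RHS]e; apply: eq_bigr => i _.
  by rewrite vE.
rewrite -[n](size_tuple X) -fX; apply/dimvS/span_subvP => _ /tnthP[i ->].
by rewrite tnth_mktuple.
Qed.

Lemma delta_neq0 (k : fieldType) a (i : 'I_a) : (delta_mx 0 i : 'rV[k]_a) != 0.
Proof.
by apply/eqP => /matrixP/(_ 0 i); rewrite !mxE !eqxx => /eqP; rewrite oner_eq0.
Qed.

Lemma row_outer (k : fieldType) a b (p : 'rV[k]_a) (q : 'rV[k]_b) l :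
  row l (p^T *m q) = p 0 l *: q.
Proof. by apply/rowP => m; rewrite !mxE big_ord1 !mxE. Qed.

Lemma outer_eq0 (k : fieldType) a b (p : 'rV[k]_a) (q : 'rV[k]_b) :
  (p^T *m q == 0) = (p == 0) || (q == 0).
Proof.
apply/eqP/idP => [e|/orP[]/eqP->]; rewrite ?trmx0 ?mul0mx ?mulmx0 //.
have [q0|q0] := eqVneq q 0; first by rewrite orbT.
rewrite orbF; apply/eqP/rowP => l; rewrite mxE.
have := congr1 (row l) e; rewrite row_outer linear0 => /eqP.
by rewrite scaler_eq0 (negPf q0) orbF => /eqP.
Qed.

(** The pure tensors attached to the standard basis vectors sit in different rows, hence are
    independent. *)
Lemma dim_ge_left (k : fieldType) a b (D : {vspace 'M[k]_(a, b)}) :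
  (forall p : 'rV_a, p != 0 -> exists2 q : 'rV_b, q != 0 & p^T *m q \in D) ->
  (a <= \dim D)%N.
Proof.
move=> H.
have /fin_all_exists[q qP] (i : 'I_a) :
    exists q : 'rV[k]_b, q != 0 /\ (delta_mx 0 i)^T *m q \in D.
  by have [q q0 qD] := H _ (delta_neq0 k i); exists q.
apply: (dim_ge_independent (fun i => (qP i).2)) => c e i.
have := congr1 (row i) e; rewrite linear_sum linear0 (bigD1 i) //= big1.
  rewrite addr0 linearZ /= row_outer !mxE !eqxx scale1r => /eqP.
  by rewrite scaler_eq0 (negPf (qP i).1) orbF => /eqP.
move=> j ji; rewrite linearZ /= row_outer !mxE eqxx /= (eq_sym i) (negPf ji).
by rewrite scale0r scaler0.
Qed.

(** Transposition swaps the two tensor factors, so each one-sided statement yields its mirror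
    image. *)
Definition trspace (k : fieldType) a b (D : {vspace 'M[k]_(a, b)}) :
  {vspace 'M[k]_(b, a)} := (linfun trmx @: D)%VS.

Lemma mem_trspace (k : fieldType) a b (D : {vspace 'M[k]_(a, b)}) X :
  (X \in trspace D) = (X^T \in D).
Proof.
apply/memv_imgP/idP => [[Y YD ->]|XD]; first by rewrite lfunE trmxK.
by exists X^T; rewrite // lfunE /= trmxK.
Qed.

Lemma dim_trspace (k : fieldType) a b (D : {vspace 'M[k]_(a, b)}) :
  \dim (trspace D) = \dim D.
Proof.
apply/limg_dim_eq/eqP; rewrite -subv0; apply/subvP => X.
by rewrite memv_cap memv_ker lfunE memv0 /= => /andP[_] /eqP; rewrite -[X in _ -> X == _]trmxK => ->; rewrite trmx0.
Qed.

Lemma dim_ge_right (k : fieldType) a b (D : {vspace 'M[k]_(a, b)}) :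
  (forall q : 'rV_b, q != 0 -> exists2 p : 'rV_a, p != 0 & p^T *m q \in D) ->
  (b <= \dim D)%N.
Proof.
move=> H; rewrite -dim_trspace; apply: dim_ge_left => q /H[p p0 pq].
by exists p; rewrite // mem_trspace trmx_mul trmxK.
Qed.

Lemma dimv_add_line (k : fieldType) (V : vectType k) (U : {vspace V}) x :
  x \notin U -> \dim (U + <[x]>)%VS = (\dim U).+1.
Proof.
move=> xU; have x0 : x != 0 by apply: contraNneq xU => ->; apply: mem0v.
rewrite dimv_disjoint_sum ?dim_vline ?x0 ?addn1 //.
apply/eqP; rewrite -subv0; apply/subvP => y; rewrite memv_cap memv0.
move=> /andP[yU /vlineP[c yE]]; rewrite yE scaler_eq0 (negPf x0) orbF.
apply: contraNT xU => c0; rewrite yE in yU.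
by have := memvZ c^-1 yU; rewrite scalerA mulVf // scale1r.
Qed.

Lemma separating_form (k : fieldType) (V : vectType k) (U : {vspace V}) x :
  x \notin U -> exists phi : {scalar V},
    phi x = 1 /\ forall u, u \in U -> phi u = 0.
Proof.
move=> xU; pose X := [tuple of x :: vbasis U].
have fX : free X by rewrite /= free_cons (span_basis (vbasisP U)) xU (basis_free (vbasisP U)).
exists (coord X ord0); split.
  exact: (coord_free ord0 ord0 fX).
move=> u /coord_vbasis ->; rewrite linear_sum big1 // => i _.
have Xi0 : coord X ord0 (vbasis U)`_i = 0 := coord_free (lift ord0 i) ord0 fX.
by rewrite linearZ /= Xi0 mulr0.
Qed.

Lemma pencil_injective_on (k : fieldType) (V W : vectType k) (Q : {vspace V})
    (D : {vspace W}) (f g : V -> W) :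
  linear f -> linear g -> (forall x, x \in Q -> f x \in D -> x = 0) ->
  exists s : seq k, forall t, t \notin s ->
    forall x, x \in Q -> f x + t *: g x \in D -> x = 0.
Proof.
move=> fL gL finj.
pose B (z : 'rV[k]_(\dim Q)) : V := \sum_i z 0 i *: (vbasis Q)`_i.
have BL : linear B.
  move=> c z z'; rewrite /B scaler_sumr -big_split; apply: eq_bigr => i _ /=.
  by rewrite !mxE scalerDl scalerA.
have BQ z : B z \in Q.
  by apply: memv_suml => i _; apply/memvZ/vbasis_mem/mem_nth; rewrite size_tuple.
have B0 z : B z = 0 -> z = 0.
  move=> Bz; apply/rowP => i; rewrite mxE; move: i; apply/freeP: Bz.
  exact: basis_free (vbasisP Q).
have [||z /(finj _ (BQ z)) /B0 //|s sP] := @pencil_injective k _ W D (f \o B) (g \o B).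
- by move=> c z z'; rewrite /= BL fL.
- by move=> c z z'; rewrite /= BL gL.
exists s => t /sP h x xQ.
have -> : x = B (\row_i coord (vbasis Q) i x).
  by rewrite [LHS](coord_vbasis xQ); apply: eq_bigr => i _; rewrite mxE.
move=> /h ->; apply/eqP; rewrite /B big1 // => i _.
by rewrite mxE scale0r.
Qed.

(* Q is a minimal subspace containing, for every p <> 0, some q <> 0 with
   p^T q in D, and p1^T q1 is a pure tensor of D for which q1 is unique in Q up
   to scalars.  Differentiating along p1 + t x gives tensors x^T q1 + p1^T q' in
   D, spanning a dimensions; each further dimension of 'rV_b gives a pure tensor
   independent of the previous ones. *)
Lemma dim_ge_both (k : fieldType) (fresh : forall s : seq k, exists t, t \notin s)
    a b (D : {vspace 'M[k]_(a, b)}) :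
  (0 < a)%N -> (0 < b)%N ->
  (forall p : 'rV_a, p != 0 -> exists2 q : 'rV_b, q != 0 & p^T *m q \in D) ->
  (forall q : 'rV_b, q != 0 -> exists2 p : 'rV_a, p != 0 & p^T *m q \in D) ->
  (a + b <= (\dim D).+1)%N.
Proof.
move=> a0 b0 HL HR.
pose Pr (Q : {vspace 'rV[k]_b}) := forall p : 'rV_a, p != 0 ->
  exists q : 'rV_b, [/\ q \in Q, q != 0 & p^T *m q \in D].
have exQ : exists n, `[< exists2 Q, Pr Q & \dim Q = n >].
  exists (\dim {: 'rV[k]_b}); apply/asboolP; exists {: 'rV[k]_b}%VS => //.
  by move=> p /HL[q q0 qD]; exists q; rewrite memvf.
case: (ex_minnP exQ) => _ /asboolP[Q PrQ <-] minQ.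
have {minQ} smallP (H : {vspace 'rV[k]_b}) : (\dim H < \dim Q)%N ->
    exists2 p : 'rV_a, p != 0 & forall q, q \in H -> p^T *m q \in D -> q = 0.
  move=> dH; apply: contrapT => nH; move: dH; rewrite ltnNge => /negP; apply.
  apply: minQ; apply/asboolP; exists H => // p p0.
  apply: contrapT => nq; apply: nH; exists p => // q qH qD.
  by apply/eqP; apply: contrapT => /negP q0; apply: nq; exists q.
have [q0 q0Q q00] : exists2 q, q \in Q & q != 0.
  have [q [qQ q0 _]] := PrQ _ (delta_neq0 k (Ordinal a0)).
  by exists q.
(* [H] is a hyperplane of [Q]. By minimality of [Q] some [p1] has no nonzero partner in [H], so its
   partner [q1] spans a complement of [H] in [Q]; [phi] below is the coordinate along [q1]. *)
pose H := (Q :\: <[q0]>)%VS.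
have dH : (\dim H).+1 = \dim Q.
  rewrite -(dimv_cap_compl Q <[q0]>) -add1n; congr (_ + _)%N.
  suff -> : (Q :&: <[q0]>)%VS = <[q0]>%VS by rewrite dim_vline q00.
  by apply/capv_idPr; rewrite -memvE.
have HQ : (H <= Q)%VS by apply: diffvSl.
have [|p1 p10 p1H] := smallP H; first by rewrite -dH.
have [q1 [q1Q q10 pq1]] := PrQ _ p10.
have q1H : q1 \notin H by apply: contra q10 => /p1H ->.
have QE : Q = (H + <[q1]>)%VS.
  apply/esym/eqP; rewrite eqEdim dimv_add_line // dH leqnn andbT.
  by rewrite subv_add HQ -memvE.
have [phi [phi1 phiH]] := separating_form q1H.
have phiZ c x : phi (c *: x) = c * phi x by apply: linearZ.
have phiD x y : phi (x + y) = phi x + phi y by apply: linearD.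
have redH q : q \in Q -> q - phi q *: q1 \in H.
  rewrite QE => /memv_addP[h hH [_ /vlineP[c ->] ->]].
  by rewrite phiD phiH // add0r phiZ phi1 mulr1 addrK.
have tangent (x : 'rV[k]_a) :
    exists2 q', q' \in H & x^T *m q1 + p1^T *m q' \in D.
  apply: contrapT => nq'.
  pose f (q : 'rV[k]_b) := p1^T *m q + phi q *: (x^T *m q1).
  pose g (q : 'rV[k]_b) := x^T *m (q - phi q *: q1).
  have fL : linear f.
    move=> c q q'; rewrite /f mulmxDr -scalemxAr phiD phiZ scalerDl.
    by rewrite scalerDr addrACA scalerA.
  have gL : linear g.
    move=> c q q'; rewrite /g scalemxAr -mulmxDr; congr (_ *m _).
    rewrite phiD phiZ scalerDl scalerBr scalerA.
    by rewrite opprD addrACA.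
  (* If [phi q = 0], then [q] is a partner of [p1] in [H], hence 0; otherwise division by [phi q]
     produces the [q'] assumed not to exist. *)
  have finj q : q \in Q -> f q \in D -> q = 0.
    move=> qQ fD; have hH := redH _ qQ.
    have fE : f q - phi q *: (p1^T *m q1) \in D by rewrite memvB ?memvZ.
    have {}fE : p1^T *m (q - phi q *: q1) + phi q *: (x^T *m q1) \in D.
      by move: fE; rewrite /f addrAC scalemxAr -mulmxBr.
    have [e|ne] := eqVneq (phi q) 0.
      rewrite e !scale0r subr0 addr0 in fE hH.
      exact: p1H.
    case: nq'; exists ((phi q)^-1 *: (q - phi q *: q1)); first exact: memvZ.
    have := memvZ (phi q)^-1 fE.
    by rewrite scalerDr scalerA mulVf // scale1r scalemxAr addrC.
  (* If no such q' existed, f would be injective on Q modulo D, hence so would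
     f + t g for generic t; but modulo D it is q |-> (p1 + t x)^T q up to a
     rescaling of the q1-coordinate, which is never injective on Q. *)
  have [s sP] := pencil_injective_on fL gL finj.
  have [t] := fresh (0 :: s); rewrite inE negb_or => /andP[t0 ts].
  have [e|ne] := eqVneq (p1 + t *: x) 0.
    case: nq'; exists 0; rewrite ?mem0v // mulmx0 addr0.
    have -> : x = - t^-1 *: p1.
      move/eqP: e; rewrite addr_eq0 => /eqP ->.
      by rewrite scaleNr scalerN opprK scalerA mulVf // scale1r.
    by rewrite linearZ /= -scalemxAl memvZ.
  have [q [qQ qn qD]] := PrQ _ ne.
  pose q' := q - phi q *: q1 + (t * phi q) *: q1.
  have phih : phi (q - phi q *: q1) = 0 by apply/phiH/redH.
  have phiq' : phi q' = t * phi q.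
    by rewrite phiD phih add0r phiZ phi1 mulr1.
  have q'0 : q' = 0.
    apply: (sP t ts).
      by rewrite memvD ?memvZ // (subvP HQ) // redH.
    rewrite /f /g phiq' /q' addrK.
    have -> : p1^T *m (q - phi q *: q1 + (t * phi q) *: q1) +
       (t * phi q) *: (x^T *m q1) + t *: (x^T *m (q - phi q *: q1)) =
       (p1 + t *: x)^T *m q + ((t * phi q) - phi q) *: (p1^T *m q1).
      rewrite [(p1 + _)^T]linearD /= [(t *: x)^T]linearZ /= mulmxDl -scalemxAl.
      rewrite !mulmxDr !mulmxN -!scalemxAr.
      rewrite scalerBr scalerA scalerBl.
      rewrite addrA addrAC addrK [RHS]addrAC; congr (_ + _).
      by rewrite -addrA [- _ + _]addrC.
    by rewrite memvD ?memvZ.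
  move/eqP: (phiq'); rewrite q'0 linear0 eq_sym mulf_eq0 (negPf t0) /= => /eqP e.
  move: q'0; rewrite /q' e mulr0 !scale0r addr0 subr0 => qz.
  by rewrite qz eqxx in qn.
(* The part of [D] inside k^a ⊗ Z + p1 ⊗ Q. The second summand admits the tensors of [tangent],
   whose correction term [p1^T *m q'] has its rows in [Q] but perhaps not in [Z]. *)
pose TP (Z : {vspace 'rV[k]_b}) : {pred 'M[k]_(a, b)} := fun X =>
  `[< X \in D /\ exists2 q', q' \in Q & forall l, row l (X - p1^T *m q') \in Z >].
have TPc Z : submod_closed (TP Z).
  split.
    apply/asboolP; split; rewrite ?mem0v //; exists 0; rewrite ?mem0v // => l.
    by rewrite mulmx0 subr0 linear0 mem0v.
  move=> c X Y /asboolP[XD [q' q'Q qZ]] /asboolP[YD [q2 q2Q q2Z]].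
  apply/asboolP; split; first by rewrite memvD ?memvZ.
  exists (c *: q' + q2); first by rewrite memvD ?memvZ.
  move=> l; have -> : c *: X + Y - p1^T *m (c *: q' + q2) =
      c *: (X - p1^T *m q') + (Y - p1^T *m q2).
    by rewrite mulmxDr -scalemxAr scalerBr opprD addrACA.
  by rewrite linearD linearZ /= memvD ?memvZ.
have /choice[T TE] Z : exists U : {vspace 'M[k]_(a, b)}, U =i TP Z.
  exact: closed_vspace (TPc Z).
have TD Z : (T Z <= D)%VS.
  by apply/subvP => X; rewrite TE => /asboolP[].
have TS Z Z' : (Z <= Z')%VS -> (T Z <= T Z')%VS.
  move=> /subvP ZZ; apply/subvP => X; rewrite !TE => /asboolP[XD [q' q'Q qZ]].
  by apply/asboolP; split=> //; exists q' => // l; apply/ZZ/qZ.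
have Tpure (Z : {vspace 'rV[k]_b}) (p : 'rV_a) q : q \in Z -> p^T *m q \in D -> p^T *m q \in T Z.
  move=> qZ pqD; rewrite TE; apply/asboolP; split=> //; exists 0.
    exact: mem0v.
  by move=> l; rewrite mulmx0 subr0 row_outer memvZ.
(* [Z] climbs a flag that starts at the line of [q1], fills [Q], and then fills the whole space. The
   dimension of [T Z] is at least [a] at the start and grows at every step. *)
suff chain n : (n < b)%N -> exists Z : {vspace 'rV[k]_b},
    [/\ q1 \in Z, (Z <= Q)%VS || (Q <= Z)%VS, \dim Z = n.+1 &
        (a + n.+1 <= (\dim (T Z)).+1)%N].
  have bE : b = b.-1.+1 by rewrite prednK.
  have [|Z [_ _ _ h]] := chain b.-1; first by rewrite -bE.
  by rewrite {1}bE (leq_trans h) // ltnS dimvS.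
have grow (Z : {vspace 'rV[k]_b}) (p : 'rV_a) q : q \notin Z -> p^T *m q \in D -> p^T *m q \notin T Z ->
    (\dim (T Z) < \dim (T (Z + <[q]>)%VS))%N.
  move=> qZ pqD pqT.
  rewrite (leq_trans _ (dimvS (_ : T Z + <[p^T *m q]> <= _)%VS)) //.
    by rewrite dimv_add_line.
  rewrite subv_add TS ?addvSl //= -memvE Tpure //.
  by rewrite memvE addvSr.
elim: n => [_|n IHn nb].
  exists <[q1]>%VS; rewrite memv_line -memvE q1Q dim_vline q10; split=> //.
  have /fin_all_exists[q' q'P] (i : 'I_a) : exists q', q' \in H /\
      (delta_mx 0 i)^T *m q1 + p1^T *m q' \in D.
    by have [q' q'H q'D] := tangent (delta_mx 0 i); exists q'.
  rewrite addn1 ltnS.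
  apply: (dim_ge_independent
    (v := fun i => (delta_mx 0 i)^T *m q1 + p1^T *m q' i)) => [i|c e l].
    rewrite TE; apply/asboolP; split; first exact: (q'P i).2.
    exists (q' i); first exact: (subvP HQ _ (q'P i).1).
    by move=> l; rewrite addrK row_outer memvZ ?memv_line.
  (* [phi] kills the corrections [q' i], which lie in [H], so [phi] of row [l] reads off the
     coefficient [c l]. *)
  have := congr1 (phi \o row l) e; rewrite /= !linear_sum !linear0 (bigD1 l) //=.
  have rowE i : phi (row l ((delta_mx 0 i)^T *m q1 + p1^T *m q' i)) = (l == i)%:R.
    rewrite linearD /= !row_outer phiD !phiZ phi1 (phiH _ (q'P i).1).
    by rewrite mulr0 addr0 mxE /= mulr1.
  rewrite big1 => [|i il].
    by rewrite addr0 linearZ /= phiZ rowE eqxx mulr1.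
  by rewrite linearZ /= phiZ rowE eq_sym (negPf il) mulr0.
have [|Z [q1Z ZQ dZ h]] := IHn; first exact: ltnW.
have [QZ|QZ] := boolP (Q <= Z)%VS.
  (* Once [Z] contains [Q], any [q] outside [Z] will do: a pure tensor [p^T *m q] in [T Z] would
     have all its rows in [Z], forcing [p = 0]. *)
  have [q qZ] : exists q, q \notin Z.
    apply: contrapT => nq; move: nb; rewrite -dZ ltnNge => /negP; apply.
    have -> : Z = fullv.
      apply/eqP; rewrite eqEsubv subvf; apply/subvP => q _.
      by apply: contrapT => /negP qZ; apply: nq; exists q.
    by rewrite dimvf /dim /= mul1n.
  have q0' : q != 0 by apply: contraNneq qZ => ->; apply: mem0v.
  have [p pn pqD] := HR q q0'.
  exists (Z + <[q]>)%VS; split.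
  - by rewrite (subvP (addvSl _ _)).
  - by rewrite (subv_trans QZ (addvSl _ _)) orbT.
  - by rewrite dimv_add_line // dZ.
  rewrite addnS ltnS (leq_trans h) // (grow Z p) //.
  rewrite TE; apply/asboolP => -[_ [q2 q2Q q2Z]]; case/eqP: pn.
  apply/rowP => l; rewrite mxE; apply/eqP; apply: contraNT qZ => pl.
  have := q2Z l; rewrite linearB /= !row_outer => /memvD/(_ (memvZ (p1 0 l) (subvP QZ _ q2Q))).
  by rewrite subrK => /(memvZ (p 0 l)^-1); rewrite scalerA mulVf // scale1r.
have {}ZQ : (Z <= Q)%VS by rewrite (negPf QZ) orbF in ZQ.
have [p pn pZ] : exists2 p : 'rV_a, p != 0 & forall q, q \in Z -> p^T *m q \in D -> q = 0.
  apply: smallP; rewrite ltnNge; apply: contra QZ => dQ.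
  by have := eqEdim Z Q; rewrite ZQ dQ => /eqP->; rewrite subvv.
have [q [qQ qn pqD]] := PrQ p pn.
have qZ : q \notin Z by apply: contra qn => qZ; apply/eqP/pZ.
exists (Z + <[q]>)%VS; split.
- by rewrite (subvP (addvSl _ _)).
- by rewrite subv_add ZQ -memvE qQ.
- by rewrite dimv_add_line // dZ.
rewrite addnS ltnS (leq_trans h) // (grow Z p) //.
rewrite TE; apply/asboolP => -[_ [q2 q2Q q2Z]].
have {}q2Z l : p 0 l *: q - p1 0 l *: q2 \in Z.
  by have := q2Z l; rewrite linearB /= !row_outer.
(* Eliminating [q2] between two rows puts each 2 by 2 minor of [p] and [p1], times [q], into [Z]. As
   [q] is outside [Z], the minors vanish and [p] is a multiple of [p1]; then [q1], which lies in
   [Z], is a partner of [p], against the choice of [p]. *)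
have minor l m : p 0 l * p1 0 m - p 0 m * p1 0 l = 0.
  apply/eqP; apply: contraNT qZ => mn.
  suff /(memvZ (p 0 l * p1 0 m - p 0 m * p1 0 l)^-1) :
      (p 0 l * p1 0 m - p 0 m * p1 0 l) *: q \in Z.
    by rewrite scalerA mulVf // scale1r.
  have -> : (p 0 l * p1 0 m - p 0 m * p1 0 l) *: q =
      p1 0 m *: (p 0 l *: q - p1 0 l *: q2) - p1 0 l *: (p 0 m *: q - p1 0 m *: q2).
    rewrite !scalerBr !scalerA opprB addrA [p1 0 l * p1 0 m]mulrC subrK.
    by rewrite scalerBl ![p1 0 _ * p _ _]mulrC.
  by rewrite memvB ?memvZ.
have [m pm] : exists m, p1 0 m != 0.
  apply: contrapT => nm; case/eqP: p10; apply/rowP => m; rewrite mxE.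
  by apply/eqP; apply: contrapT => /negP pm; apply: nm; exists m.
have pE : p = (p 0 m / p1 0 m) *: p1.
  apply/rowP => l; rewrite mxE mulrAC; apply/eqP.
  by rewrite -subr_eq0 -(mulfK pm (p 0 l)) -mulrBl minor mul0r.
have := pZ q1 q1Z; rewrite pE linearZ /= -scalemxAl memvZ // => /(_ isT) q1z.
by rewrite q1z eqxx in q10.
Qed.

(* By uniform_vertex every vertex selects an edge at which the pure tensors of
   that edge's space cover the whole space of the vertex.  An edge selected by one
   end has dim D >= dim of that end, and one selected by both ends has
   dim D >= the sum of the two dimensions minus 1; summing dim - 1 over edges
   dominates the sum of dim - 1 over vertices. *)
Lemma vertex_edge_count (k : fieldType)
    (fresh : forall s : seq k, exists t, t \notin s)
    (I : finType) (t u : I -> nat)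
    (D : forall i j, {vspace 'M[k]_(t j, u i)}) :
  (forall j (p : 'rV_(t j)), p != 0 ->
     exists i, exists2 q : 'rV_(u i), q != 0 & p^T *m q \in D i j) ->
  (forall i (q : 'rV_(u i)), q != 0 ->
     exists j, exists2 p : 'rV_(t j), p != 0 & p^T *m q \in D i j) ->
  (\sum_j t j + \sum_i u i + #|[set ij : I * I | D ij.1 ij.2 != 0%VS]| <=
   \sum_(ij : I * I) \dim (D ij.1 ij.2) +
   (#|[set i | [exists j, D i j != 0%VS]]| + #|[set j | [exists i, D i j != 0%VS]]|))%N.
Proof.
move=> H1 H2; pose nz i j := D i j != 0%VS.
have nzP i j (X : 'M_(t j, u i)) : X \in D i j -> X != 0 -> nz i j.
  by move=> XD; apply: contraNN => /eqP D0; rewrite -memv0 -D0.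
have outer0 a b (p : 'rV[k]_a) (q : 'rV_b) : p != 0 -> q != 0 -> p^T *m q != 0.
  by rewrite outer_eq0 negb_or => -> ->.
have nz_gt0 i j : nz i j -> (0 < t j)%N && (0 < u i)%N.
  apply: contraNT => z; apply/eqP/vspaceP => X.
  suff -> : X = 0 by rewrite !mem0v.
  by apply/matrixP => l m; move: z; rewrite negb_and -!eqn0Ngt => /orP[]/eqP z;
    [have := ltn_ord l|have := ltn_ord m]; rewrite [X in (_ < X)%N]z.
(* An index lies on an edge exactly when its space is nonzero, so the truncated predecessors below
   lose nothing at isolated indices. *)
have tE j : [exists i, nz i j] = (0 < t j)%N.
  apply/existsP/idP => [[i /nz_gt0/andP[]] //|tj].
  have [i [q q0 qD]] := H1 j _ (delta_neq0 k (Ordinal tj)).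
  by exists i; apply: nzP qD _; rewrite outer0 ?delta_neq0.
have uE i : [exists j, nz i j] = (0 < u i)%N.
  apply/existsP/idP => [[j /nz_gt0/andP[]] //|ui].
  have [j [p p0 pD]] := H2 i _ (delta_neq0 k (Ordinal ui)).
  by exists j; apply: nzP pD _; rewrite outer0 ?delta_neq0.
(* When [t j = 0] the selected edge is a placeholder; it will carry the weight [(t j).-1 = 0]. *)
have /fin_all_exists[e eP] j : exists i, (0 < t j)%N ->
    forall p : 'rV_(t j), p != 0 -> exists2 q : 'rV_(u i), q != 0 & p^T *m q \in D i j.
  have [tj|] := posnP (t j); first by exists j.
  by move=> tj; have [i iP] := uniform_vertex fresh (D := D^~ j) tj (H1 j); exists i.
have /fin_all_exists[e' eP'] i : exists j, (0 < u i)%N ->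
    forall q : 'rV_(u i), q != 0 -> exists2 p : 'rV_(t j), p != 0 & p^T *m q \in D i j.
  have [ui|ui] := posnP (u i); first by exists i.
  have [|j jP] := @uniform_vertex k fresh _ I t (fun j => trspace (D i j)) ui.
    move=> q /H2[j [p p0 pD]]; exists j; exists p => //.
    by rewrite mem_trspace trmx_mul trmxK.
  exists j => _ q /jP[p p0]; rewrite mem_trspace trmx_mul trmxK.
  by exists p.
have local i j : ((if e j == i then (t j).-1 else 0) +
    (if e' i == j then (u i).-1 else 0) + nz i j <= \dim (D i j))%N.
  have [ze|nze] := boolP (nz i j); last first.
    rewrite addn0.
    have -> : (if e j == i then (t j).-1 else 0) = 0%N.
      case: eqP => // ei; case: (posnP (t j)) => [->//|tj].
      have [q q0 qD] := eP j tj _ (delta_neq0 k (Ordinal tj)).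
      case/negP: nze; rewrite -{i}ei in q q0 qD *.
      by apply: nzP qD _; rewrite outer0 ?delta_neq0.
    rewrite add0n.
    have -> : (if e' i == j then (u i).-1 else 0) = 0%N; last by [].
    case: eqP => // ej; case: (posnP (u i)) => [->//|ui].
    have [p p0 pD] := eP' i ui _ (delta_neq0 k (Ordinal ui)).
    case/negP: nze; rewrite -{j}ej in p p0 pD *.
    by apply: nzP pD _; rewrite outer0 ?delta_neq0.
  have /andP[tj ui] := nz_gt0 _ _ ze.
  have dD : (0 < \dim (D i j))%N by rewrite lt0n dimv_eq0.
  rewrite addn1; case: eqP => ei; case: eqP => ej.
  - have : (t j + u i <= (\dim (D i j)).+1)%N.
      apply: dim_ge_both => //; first by move: (eP j tj); rewrite ei.
      by move: (eP' i ui); rewrite ej.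
    move: (\dim _) tj ui => d; case: (t j) (u i) => [|x] [|y] // _ _ h.
    by move: h; rewrite addSn addnS !ltnS.
  - by rewrite addn0 prednK //; apply: dim_ge_left; move: (eP j tj); rewrite ei.
  - by rewrite add0n prednK //; apply: dim_ge_right; move: (eP' i ui); rewrite ej.
  - by [].
(* Writing each dimension as its predecessor plus one when positive brings out the vertex counts,
   which cancel and leave the sum of [local] over all edges. *)
have sumE (f : I -> nat) (g : I -> bool) : (forall i, g i = (0 < f i)%N) ->
    (\sum_i f i = \sum_i (f i).-1 + #|[set i | g i]|)%N.
  move=> gE; rewrite -sum1dep_card [X in (_ + X)%N]big_mkcond -big_split; apply: eq_bigr => i _ /=.
  by rewrite gE; case: (f i) => //= n; rewrite addn1.
rewrite (sumE _ _ tE) (sumE _ _ uE).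
have -> : (#|[set ij : I * I | D ij.1 ij.2 != 0%VS]| = \sum_i \sum_j nz i j)%N.
  rewrite -sum1dep_card big_mkcond -(pair_big xpredT xpredT (fun i j => if nz i j then 1 else 0)%N) /=.
  by apply: eq_bigr => i _; apply: eq_bigr => j _; case: (nz i j).
have -> : (\sum_(ij : I * I) \dim (D ij.1 ij.2) = \sum_i \sum_j \dim (D i j))%N.
  by rewrite (pair_big xpredT xpredT (fun i j => \dim (D i j))).
have -> : (\sum_j (t j).-1 = \sum_i \sum_j if e j == i then (t j).-1 else 0)%N.
  rewrite exchange_big; apply: eq_bigr => j _.
  by rewrite -big_mkcond (big_pred1 (e j)) // => i; rewrite eq_sym.
have -> : (\sum_i (u i).-1 = \sum_i \sum_j if e' i == j then (u i).-1 else 0)%N.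
  apply: eq_bigr => i _.
  by rewrite -big_mkcond (big_pred1 (e' i)) // => j; rewrite eq_sym.
rewrite addnACA addnAC [X in (_ + X <= _)%N]addnC leq_add2r -!big_split /=.
apply: leq_sum => i _; rewrite -!big_split /=; apply: leq_sum => j _.
exact: local.
Qed.

(** * Modules over R as vector spaces over [k], with scalars acting through [iota] *)

Section RestrictionOfScalars.
Variables (k : fieldType) (R : nzRingType) (iota : {rmorphism k -> R}).
Implicit Types V : lmodType R.

Definition kclosed (V : lmodType R) (P : {pred V}) : Prop :=
  0 \in P /\ forall c x y, x \in P -> y \in P -> iota c *: x + y \in P.

Definition klinear (V : lmodType R) n (f : V -> 'rV[k]_n) : Prop :=
  forall c x y, f (iota c *: x + y) = c *: f x + f y.

Definition kspanned (V : lmodType R) : Prop :=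
  exists n (e : 'I_n -> V), forall x, exists c : 'I_n -> k,
    x = \sum_i iota (c i) *: e i.

Lemma klinear0 V n (f : V -> 'rV[k]_n) : klinear f -> f 0 = 0.
Proof.
by move=> /(_ (-1) 0 0); rewrite scaler0 add0r scaleN1r addNr.
Qed.

Lemma klinearZ V n (f : V -> 'rV[k]_n) : klinear f ->
  forall c x, f (iota c *: x) = c *: f x.
Proof. by move=> fL c x; rewrite -[_ *: x]addr0 fL klinear0 ?addr0. Qed.

Lemma klinearD V n (f : V -> 'rV[k]_n) : klinear f ->
  forall x y, f (x + y) = f x + f y.
Proof. by move=> fL x y; rewrite -{1}[x]scale1r -(rmorph1 iota) fL scale1r. Qed.

Lemma klinearB V n (f : V -> 'rV[k]_n) : klinear f ->
  forall x y, f (x - y) = f x - f y.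
Proof.
by move=> fL x y; rewrite addrC -(scaleN1r y) -(rmorphN1 iota) fL scaleN1r addrC.
Qed.

Lemma klinear_sum V n (f : V -> 'rV[k]_n) : klinear f ->
  forall (I : Type) (r : seq I) (F : I -> V),
    f (\sum_(i <- r) F i) = \sum_(i <- r) f (F i).
Proof.
move=> fL I r F; elim: r => [|i r IHr]; first by rewrite !big_nil klinear0.
by rewrite !big_cons klinearD // IHr.
Qed.

(** The spanning family gives a [k]-linear surjection from a row space onto [V]; pulling [P] back
    along it reduces the quotient by [P] to one of ordinary vector spaces. *)
Lemma quotient_coordinates (V : lmodType R) (P : {pred V}) :
  kspanned V -> kclosed P ->
  exists t (f : V -> 'rV[k]_t), [/\ klinear f,
    forall x, f x = 0 <-> x \in P & forall p, exists x, f x = p].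
Proof.
move=> [n [e eP]] [P0 PL].
pose g (p : 'rV[k]_n) : V := \sum_i iota (p 0 i) *: e i.
have gL c p q : g (c *: p + q) = iota c *: g p + g q.
  rewrite /g scaler_sumr -big_split; apply: eq_bigr => i _ /=.
  by rewrite !mxE rmorphD rmorphM scalerDl scalerA.
have gs x : exists p, g p = x.
  have [c ->] := eP x; exists (\row_i c i).
  by apply: eq_bigr => i _; rewrite mxE.
pose Pg : {pred 'rV[k]_n} := fun p => g p \in P.
have PgE p : (p \in Pg) = (g p \in P) by [].
have [|U UE'] := @closed_vspace k _ Pg.
  split=> [|c p q pP qP]; last by rewrite PgE gL PL.
  rewrite PgE /g big1 // => i _.
  by rewrite mxE rmorph0 scale0r.
have UE p : (p \in U) = (g p \in P) by rewrite UE' PgE.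
pose pr := (\1 - projv U)%VF.
have prU x : (pr x == 0) = (x \in U).
  rewrite /pr add_lfunE opp_lfunE id_lfunE subr_eq0.
  apply/eqP/idP => [->|/projv_id -> //]; exact: memv_proj.
pose W := limg pr.
pose a p : 'rV[k]_(\dim W) := \row_i coord (vbasis W) i (pr p).
have aL c p q : a (c *: p + q) = c *: a p + a q.
  by apply/rowP => i; rewrite !mxE !linearP.
have a0 p : a p = 0 <-> p \in U.
  rewrite -prU; split=> [ap|/eqP prp]; last first.
    by apply/rowP => i; rewrite !mxE prp linear0.
  rewrite (coord_vbasis (memv_img pr (memvf p))) big1 // => i _.
  by move/rowP/(_ i): ap; rewrite !mxE => ->; rewrite scale0r.
have as_ q : exists p, a p = q.
  have : \sum_i q 0 i *: (vbasis W)`_i \in W.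
    by apply: memv_suml => i _; apply/memvZ/vbasis_mem/mem_nth; rewrite size_tuple.
  move=> /memv_imgP[p _ pE]; exists p; apply/rowP => i.
  by rewrite mxE -pE coord_sum_free // (basis_free (vbasisP W)).
(* [h] is a bare section of [g]. It need not be linear, but [a] is constant on the fibres of [g], so
   the composite is. *)
have [h hK] := choice gs.
have aeq p q : g p = g q -> a p = a q.
  move=> gpq; apply/eqP; rewrite -subr_eq0 addrC -scaleN1r -aL; apply/eqP/a0.
  by rewrite UE gL gpq rmorphN1 scaleN1r addNr.
exists (\dim W), (fun x => a (h x)); split=> [c x y|x|q].
- by rewrite -aL; apply: aeq; rewrite gL !hK.
- by rewrite a0 UE hK.
by have [p <-] := as_ q; exists (g p); apply: aeq; rewrite hK.
Qed.

Lemma subspace_coordinates V (P : {pred V}) :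
  kspanned V -> kclosed P ->
  exists u (b : 'rV[k]_u -> V),
    [/\ forall c p q, b (c *: p + q) = iota c *: b p + b q,
        forall p, b p = 0 -> p = 0 & forall x, x \in P <-> exists p, b p = x].
Proof.
move=> Vs [P0 PL].
have [|n [f [fL f0 fs]]] := quotient_coordinates (P := pred1 0) Vs.
  by split=> [|c x y /eqP-> /eqP->]; rewrite inE ?scaler0 ?addr0.
have finj x y : f x = f y -> x = y.
  move=> fxy; apply/eqP; rewrite -subr_eq0; apply/f0.
  by rewrite klinearB // fxy subrr.
have [g gK] := choice fs.
have gL c p q : g (c *: p + q) = iota c *: g p + g q.
  by apply: finj; rewrite fL !gK.
have fK x : g (f x) = x by apply: finj; rewrite gK.
pose Pg : {pred 'rV[k]_n} := fun p => g p \in P.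
have PgE p : (p \in Pg) = (g p \in P) by [].
have [|U UE'] := @closed_vspace k _ Pg.
  split=> [|c p q pP qP]; last by rewrite PgE gL PL.
  by rewrite PgE -(klinear0 fL) fK.
have UE p : (p \in U) = (g p \in P) by rewrite UE' PgE.
exists (\dim U), (fun p : 'rV[k]_(\dim U) => g (\sum_i p 0 i *: (vbasis U)`_i)); split=> [c p q|p gp|x].
- rewrite -gL; congr g; rewrite scaler_sumr -big_split; apply: eq_bigr => i _ /=.
  by rewrite !mxE scalerDl scalerA.
- have /(congr1 f) := gp; rewrite gK klinear0 // => e.
  by apply/rowP => i; rewrite mxE; move: i; apply/freeP: e; apply: basis_free (vbasisP U).
split=> [xP|[p <-]].
  exists (\row_i coord (vbasis U) i (f x)); rewrite -[RHS]fK; congr g.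
  rewrite [RHS](coord_vbasis (_ : _ \in U)) ?UE ?fK //.
  by apply: eq_bigr => i _; rewrite mxE.
rewrite -UE; apply: memv_suml => i _; apply/memvZ/vbasis_mem/mem_nth.
by rewrite size_tuple.
Qed.

(** A bounded, strictly monotone size for [k]-closed sets. Minimal and maximal ideals, families and
    submodules are later chosen by this number, in place of chain conditions. *)
Lemma kdimension V : kspanned V ->
  exists n (d : {pred V} -> nat), forall P Q, kclosed P -> kclosed Q ->
    {subset P <= Q} ->
    [/\ (d P <= d Q)%N, (d Q <= n)%N & (d Q <= d P)%N -> {subset Q <= P}].
Proof.
move=> Vs.
have [|n [f [fL f0 fs]]] := quotient_coordinates (P := pred1 0) Vs.
  by split=> [|c x y /eqP-> /eqP->]; rewrite inE ?scaler0 ?addr0.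
have finj x y : f x = f y -> x = y.
  move=> fxy; apply/eqP; rewrite -subr_eq0; apply/f0.
  by rewrite klinearB // fxy subrr.
have [g gK] := choice fs.
have gL c p q : g (c *: p + q) = iota c *: g p + g q.
  by apply: finj; rewrite fL !gK.
have fK x : g (f x) = x by apply: finj; rewrite gK.
have /choice[U UE] (P : {pred V}) : exists U : {vspace 'rV[k]_n},
    kclosed P -> forall x, (f x \in U) = (x \in P).
  have [Pc|nPc] := pselect (kclosed P); last by exists 0%VS.
  pose Pg : {pred 'rV[k]_n} := fun p => g p \in P.
  have PgE p : (p \in Pg) = (g p \in P) by [].
  have [|U UE'] := @closed_vspace k _ Pg.
    split=> [|c p q pP qP]; last by rewrite PgE gL Pc.2.
    by rewrite PgE -(klinear0 fL) fK Pc.1.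
  by exists U => _ x; rewrite UE' PgE fK.
exists n, (fun P => \dim (U P)) => P Q Pc Qc PQ.
have UPQ : (U P <= U Q)%VS.
  by apply/subvP => p; rewrite -(gK p) !UE //; apply: PQ.
split; first exact: dimvS.
  by rewrite (leq_trans (dimvS (subvf _))) // dimvf /dim /= mul1n.
move=> dQP x xQ; have := eqEdim (U P) (U Q); rewrite UPQ dQP => /eqP e.
by rewrite -(UE P) // e UE.
Qed.

End RestrictionOfScalars.

(** * Nilpotence of the Jacobson radical, and the socle of R *)

Section JacobsonSocle.
Variables (k : fieldType) (R : nzRingType) (iota : {rmorphism k -> R}).
Hypothesis R_findim : finite_dim_left iota.

Lemma submod_kclosed (V : lmodType R) (P : {pred V}) :
  submod_closed P -> kclosed iota P.
Proof. by case=> P0 PL; split=> // c x y xP yP; apply: PL. Qed.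

Definition as_submod (V : lmodType R) (P : {pred V}) (cP : submod_closed P) :
    submodClosed V :=
  HB.pack P (GRing.isSubmodClosed.Build R V P (GRing.submod_closed_semi cP)).

Lemma submodClosed_closed (V : lmodType R) (U : submodClosed V) :
  submod_closed (U : {pred V}).
Proof. exact/submodClosedP. Qed.

Lemma regular_kspanned : kspanned iota R^o.
Proof.
by have [n [b bP]] := R_findim; exists n, b => x; have [c ->] := bP x; exists c.
Qed.

Lemma ideal_submod (K : {pred R}) : ideal_closed K -> submod_closed (K : {pred R^o}).
Proof.
move=> [[K0 KB] Kl]; split=> // r x y xK yK.
have yN : - y \in K by rewrite -sub0r KB.
by rewrite -[y]opprK; apply: KB => //; apply: (Kl r x xK).1.
Qed.

Lemma maximal_left_above (K : submodClosed R^o) : 1 \notin K ->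
  exists2 I : submodClosed R^o, maximal_left_ideal I & {subset K <= I}.
Proof.
move=> K1; have [n [d dP]] := kdimension regular_kspanned.
pose Q m := `[< exists I : submodClosed R^o,
  [/\ {subset K <= I}, 1 \notin I & d I = m] >].
have exQ : exists m, Q m.
  exists (d K); apply/asboolP; exists K; split=> //.
have kc (I : submodClosed R^o) : kclosed iota I.
  exact/submod_kclosed/submodClosed_closed.
have ubQ m : Q m -> (m <= n)%N.
  move=> /asboolP[I [_ _ <-]].
  by have [_ -> _] := dP I I (kc I) (kc I) (fun x => id).
case: (ex_maxnP exQ ubQ) => _ /asboolP[I [KI I1 <-]] maxI.
exists I => //; split=> // L IL; have [L1|L1] := boolP (1 \in L).
  right=> x; rewrite -[x]mulr1; exact: (rpredZ (s := L) (x : R)).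
left; have [_ _ ] := dP I L (kc I) (kc L) IL; apply; apply: maxI.
by apply/asboolP; exists L; split=> // x /KI/IL.
Qed.

(** Otherwise R(1 - j) lies in a maximal left ideal; that ideal also contains j, hence 1. *)
Lemma jacobson_quasiregular j : j \in @jacobson R -> exists u, u * (1 - j) = 1.
Proof.
move=> /asboolP jJ.
pose P : {pred R^o} := fun x => `[< exists r : R, x = r * (1 - j) >].
have Pc : submod_closed P.
  split; first by apply/asboolP; exists 0; rewrite mul0r.
  move=> a _ _ /asboolP[r ->] /asboolP[r' ->]; apply/asboolP.
  by exists (a * r + r'); rewrite mulrDl -mulrA.
have [|P1] := boolP (1 \in as_submod Pc).
  by move=> /asboolP[u uE]; exists u.
have [I mI PI] := maximal_left_above P1.
have /PI h : (1 - j : R^o) \in as_submod Pc.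
  by apply/asboolP; exists 1; rewrite mul1r.
case/negP: mI.1; rewrite -(subrK (j : R^o) 1).
exact: (rpredD h (jJ I mI)).
Qed.

(** A form of Nakayama's lemma: 1 - j has a left inverse. *)
Lemma jacobson_cancel (V : lmodType R) (Z : {pred V}) j x :
  submod_closed Z -> j \in @jacobson R -> x - j *: x \in Z -> x \in Z.
Proof.
move=> [Z0 ZL] /jacobson_quasiregular[u uE] xZ.
rewrite -[x]scale1r -uE -scalerA scalerBl scale1r -[_ *: _]addr0.
exact: ZL.
Qed.

(* annih_chain m is the set of x with J^m x = 0. *)
Fixpoint annih_chain (m : nat) : {pred R^o} :=
  if m is n.+1 then fun x => `[< forall j, j \in @jacobson R ->
                                  (j * (x : R) : R^o) \in annih_chain n >]
  else pred1 0.

Lemma annih_chain_closed m : submod_closed (annih_chain m).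
Proof.
elim: m => [|m [Z0 ZL]].
  by split=> [|a x y /eqP-> /eqP->]; rewrite inE ?scaler0 ?addr0.
split=> [|a x y /asboolP xZ /asboolP yZ]; apply/asboolP => j jJ.
  by rewrite mulr0.
have -> : j * (a *: x + y : R) = 1 *: ((j * a) * (x : R) : R^o) + (j * (y : R) : R^o).
  by rewrite scale1r mulrDr -mulrA.
apply: ZL; last exact: yZ.
by apply: (xZ (j * a)); apply: ((jacobson_closed R).2 a j jJ).2.
Qed.

Lemma annih_chainS m : {subset annih_chain m <= annih_chain m.+1}.
Proof.
move=> x xZ; apply/asboolP => j jJ.
have [Z0 ZL] := annih_chain_closed m.
have -> : j * (x : R) = j *: x + 0 :> R^o by rewrite addr0.
exact: ZL.
Qed.

(** The chain stabilises at some m for reasons of dimension. If its limit Z is not everything, take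
    x outside Z with Rx + Z of least dimension. If jx were outside Z for some j in J, then Rjx + Z
    would equal Rx + Z and [jacobson_cancel] would put x in Z. So Jx lies in Z, and x lies in the
    next, equal, term. *)
Lemma annih_chain_full : exists m, forall x, x \in annih_chain m.
Proof.
have [n [d dP]] := kdimension regular_kspanned.
have kc m : kclosed iota (annih_chain m) by apply/submod_kclosed/annih_chain_closed.
have [m mP] : exists m, {subset annih_chain m.+1 <= annih_chain m}.
  apply: contrapT => nm.
  have dS m : (d (annih_chain m) < d (annih_chain m.+1))%N.
    rewrite ltnNge; apply/negP => dm; apply: nm; exists m.
    by have [_ _ ] := dP _ _ (kc m) (kc m.+1) (@annih_chainS m); apply.
  have dm m : (m <= d (annih_chain m))%N.
    by elim: m => // m IHm; apply: leq_ltn_trans IHm (dS m).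
  have [_ + _] := dP _ _ (kc n.+1) (kc n.+1) (fun x => id).
  by rewrite leqNgt dm.
exists m; apply: contrapT => nall.
have [Z0 ZL] := annih_chain_closed m.
pose P (x : R^o) : {pred R^o} :=
  fun y => `[< exists r : R, y - r *: x \in annih_chain m >].
have Pc x : submod_closed (P x).
  split; first by apply/asboolP; exists 0; rewrite scale0r subr0.
  move=> a y z /asboolP[r ry] /asboolP[r' rz]; apply/asboolP.
  exists (a * r + r'); have -> : a *: y + z - (a * r + r') *: x =
      a *: (y - r *: x) + (z - r' *: x).
    by rewrite scalerBr scalerDl -scalerA opprD addrACA.
  exact: ZL.
pose Q c := `[< exists2 x : R^o, x \notin annih_chain m & d (P x) = c >].
have exQ : exists c, Q c.
  have [x xZ] : exists x, x \notin annih_chain m.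
    apply: contrapT => nx; apply: nall => x.
    by apply: contrapT => /negP xZ; apply: nx; exists x.
  by exists (d (P x)); apply/asboolP; exists x.
case: (ex_minnP exQ) => _ /asboolP[x xZ <-] minx.
case/negP: xZ; apply/mP/asboolP => j jJ; apply: contrapT => /negP jx.
have sub : {subset P (j * (x : R)) <= P x}.
  move=> y /asboolP[r ry]; apply/asboolP; exists (r * j).
  by rewrite -scalerA.
have [_ _ h] := dP _ _ (submod_kclosed (Pc (j * (x : R)))) (submod_kclosed (Pc x)) sub.
have /h/(_ x) : (d (P x) <= d (P (j * (x : R))%R))%N.
  by apply: minx; apply/asboolP; exists (j * (x : R)).
have xP : x \in P x.
  by apply/asboolP; exists 1; rewrite scale1r subrr.
move=> /(_ xP)/asboolP[r rx].
have xZ : x \in annih_chain m.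
  apply: (jacobson_cancel (j := r * j) (annih_chain_closed m)).
    exact: ((jacobson_closed R).2 r j jJ).1.
  by rewrite -scalerA.
case/negP: jx; have -> : j * (x : R) = j *: x + 0 :> R^o by rewrite addr0.
exact: ZL.
Qed.

Lemma jacobson_nilpotent : exists m, forall s : seq R,
  size s = m -> {subset s <= @jacobson R} -> \prod_(j <- s) j = 0.
Proof.
have kill m (x : R) (s : seq R) : (x : R^o) \in annih_chain m ->
    size s = m -> {subset s <= @jacobson R} -> (\prod_(j <- s) j) * x = 0.
  elim: m x s => [|m IHm] x s xZ; first by rewrite (eqP xZ) mulr0.
  case/lastP: s => // s j; rewrite size_rcons => -[sm] sJ.
  rewrite big_rcons /= -mulrA; apply: IHm => //.
    by move/asboolP: xZ; apply; rewrite sJ // mem_rcons mem_head.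
  by move=> y ys; rewrite sJ // mem_rcons inE ys orbT.
have [m mP] := annih_chain_full; exists m => s sm sJ.
by rewrite -[LHS]mulr1 (kill m).
Qed.

(** Keep multiplying by elements of J as long as the product is nonzero; nilpotence ends this. *)
Lemma ideal_annihilated_left (K : {pred R}) : ideal_closed K ->
  (exists2 x, x \in K & x != 0) ->
  exists x, [/\ x \in K, x != 0 & forall j, j \in @jacobson R -> j * x = 0].
Proof.
move=> [_ KM] [y yK y0]; have [m mP] := jacobson_nilpotent.
have {mP} : forall s : seq R, size s = m -> {subset s <= @jacobson R} ->
    (\prod_(j <- s) j) * y = 0.
  by move=> s sm sJ; rewrite mP // mul0r.
elim: m y yK y0 => [|m IHm] y yK y0 yP.
  by have := yP [::] erefl; rewrite big_nil mul1r => e; rewrite e ?eqxx // in y0.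
have [ny|/existsNP[j /not_implyP[jJ /eqP jy]]] :=
    pselect (forall j, j \in @jacobson R -> j * y = 0); first by exists y.
apply: (IHm (j * y)) => //; first exact: (KM j y yK).1.
move=> s sm sJ; have := yP (rcons s j); rewrite big_rcons /= mulrA; apply.
  by rewrite size_rcons sm.
by move=> i; rewrite mem_rcons inE => /orP[/eqP->//|/sJ].
Qed.

Lemma ideal_annihilated_right (K : {pred R}) : ideal_closed K ->
  (exists2 x, x \in K & x != 0) ->
  exists x, [/\ x \in K, x != 0 & forall j, j \in @jacobson R -> x * j = 0].
Proof.
move=> [_ KM] [y yK y0]; have [m mP] := jacobson_nilpotent.
have {mP} : forall s : seq R, size s = m -> {subset s <= @jacobson R} ->
    y * (\prod_(j <- s) j) = 0.
  by move=> s sm sJ; rewrite mP // mulr0.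
elim: m y yK y0 => [|m IHm] y yK y0 yP.
  by have := yP [::] erefl; rewrite big_nil mulr1 => e; rewrite e ?eqxx // in y0.
have [ny|/existsNP[j /not_implyP[jJ /eqP jy]]] :=
    pselect (forall j, j \in @jacobson R -> y * j = 0); first by exists y.
apply: (IHm (y * j)) => //; first exact: (KM j y yK).2.
move=> s sm sJ; have := yP (j :: s); rewrite big_cons /= mulrA; apply.
  by rewrite /= sm.
by move=> i; rewrite inE => /orP[/eqP->//|/sJ].
Qed.

(** The elements of [I] killed by J on one side form a nonzero ideal inside [I], hence all of
    [I]. *)
Lemma minimal_ideal_annihilated (I : {pred R}) x j :
  minimal_ideal I -> x \in I -> j \in @jacobson R -> j * x = 0 /\ x * j = 0.
Proof.
move=> [Ic In0 Imin] xI jJ; have [[I0 IB] IM] := Ic; split.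
  pose K : {pred R} := fun y => (y \in I) &&
    `[< forall i, i \in @jacobson R -> i * y = 0 >].
  have Kc : ideal_closed K.
    split; first split.
    - by apply/andP; split=> //; apply/asboolP => i _; rewrite mulr0.
    - move=> y z /andP[yI /asboolP yJ] /andP[zI /asboolP zJ]; apply/andP.
      split; first exact: IB.
      by apply/asboolP => i iJ; rewrite mulrBr yJ // zJ // subrr.
    move=> r y /andP[yI /asboolP yJ]; split; apply/andP; split.
    - exact: (IM r y yI).1.
    - apply/asboolP => i iJ; rewrite mulrA yJ //.
      exact: ((jacobson_closed R).2 r i iJ).2.
    - exact: (IM r y yI).2.
    - by apply/asboolP => i iJ; rewrite mulrA yJ // mul0r.
  have [z [zI z0 zJ]] := ideal_annihilated_left Ic In0.
  have KI : {subset K <= I} by move=> y /andP[].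
  have Kn0 : exists2 y, y \in K & y != 0.
    by exists z => //; apply/andP; split=> //; apply/asboolP.
  have /andP[_ /asboolP] := Imin K Kc KI Kn0 x xI; exact.
pose K : {pred R} := fun y => (y \in I) &&
  `[< forall i, i \in @jacobson R -> y * i = 0 >].
have Kc : ideal_closed K.
  split; first split.
  - by apply/andP; split=> //; apply/asboolP => i _; rewrite mul0r.
  - move=> y z /andP[yI /asboolP yJ] /andP[zI /asboolP zJ]; apply/andP.
    split; first exact: IB.
    by apply/asboolP => i iJ; rewrite mulrBl yJ // zJ // subrr.
  move=> r y /andP[yI /asboolP yJ]; split; apply/andP; split.
  - exact: (IM r y yI).1.
  - by apply/asboolP => i iJ; rewrite -mulrA yJ // mulr0.
  - exact: (IM r y yI).2.
  - apply/asboolP => i iJ; rewrite -mulrA yJ //.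
    exact: ((jacobson_closed R).2 r i iJ).1.
have [z [zI z0 zJ]] := ideal_annihilated_right Ic In0.
have KI : {subset K <= I} by move=> y /andP[].
have Kn0 : exists2 y, y \in K & y != 0.
  by exists z => //; apply/andP; split=> //; apply/asboolP.
have /andP[_ /asboolP] := Imin K Kc KI Kn0 x xI; exact.
Qed.

Lemma jacobson_mul_socle j x :
  j \in @jacobson R -> x \in @ring_socle R -> j * x = 0.
Proof.
move=> jJ /asboolP[s [sI ->]]; rewrite mulr_sumr big_seq big1 // => y /sI[I mI yI].
exact: (minimal_ideal_annihilated mI yI jJ).1.
Qed.

Lemma socle_mul_jacobson j x :
  j \in @jacobson R -> x \in @ring_socle R -> x * j = 0.
Proof.
move=> jJ /asboolP[s [sI ->]]; rewrite mulr_suml big_seq big1 // => y /sI[I mI yI].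
exact: (minimal_ideal_annihilated mI yI jJ).2.
Qed.

Lemma ring_socle_ideal : ideal_closed (@ring_socle R).
Proof.
split; first split.
- by apply/asboolP; exists [::]; rewrite big_nil.
- move=> _ _ /asboolP[s [sI ->]] /asboolP[t [tI ->]]; apply/asboolP.
  exists (s ++ [seq - y | y <- t]); split; last first.
    by rewrite big_cat big_map /= sumrN.
  move=> y; rewrite mem_cat => /orP[/sI //|/mapP[z /tI[I mI zI] ->]].
  by exists I => //; have [[[I0 IB] _] _ _] := mI; rewrite -sub0r IB.
move=> r _ /asboolP[s [sI ->]]; split; apply/asboolP.
  exists [seq r * y | y <- s]; rewrite big_map mulr_sumr; split=> //.
  move=> _ /mapP[y /sI[I mI yI] ->]; exists I => //.
  by have [[_ IM] _ _] := mI; apply: (IM r y yI).1.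
exists [seq y * r | y <- s]; rewrite big_map mulr_suml; split=> //.
move=> _ /mapP[y /sI[I mI yI] ->]; exists I => //.
by have [[_ IM] _ _] := mI; apply: (IM r y yI).2.
Qed.

(** A nonzero ideal of least dimension inside [K] is minimal. This is why a failure of faithfulness
    is always witnessed by a socle element. *)
Lemma ideal_meets_socle (K : {pred R}) : ideal_closed K ->
  (exists2 x, x \in K & x != 0) ->
  exists x, [/\ x \in K, x \in @ring_socle R & x != 0].
Proof.
move=> Kc Kn0; have [n [d dP]] := kdimension regular_kspanned.
have kc (I : {pred R}) : ideal_closed I -> kclosed iota (I : {pred R^o}).
  by move=> Ic; apply/submod_kclosed/ideal_submod.
pose Q m := `[< exists I : {pred R}, [/\ ideal_closed I, {subset I <= K},
   exists2 x, x \in I & x != 0 & d I = m] >].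
have exQ : exists m, Q m by exists (d K); apply/asboolP; exists K; split.
case: (ex_minnP exQ) => _ /asboolP[I [Ic IK In0 <-]] minI.
have mI : minimal_ideal I.
  split=> // L Lc LI Ln0.
  have [_ _] := dP L I (kc L Lc) (kc I Ic) LI; apply; apply: minI.
  by apply/asboolP; exists L; split=> // x /LI/IK.
have [x xI x0] := In0; exists x; split=> //; first exact: IK.
apply/asboolP; exists [:: x]; rewrite big_seq1; split=> // y.
by rewrite inE => /eqP->; exists I.
Qed.

End JacobsonSocle.

(** * Matrices of factored maps, rank one matrices, lengths from chains, annihilator ideals *)

(** [h] factors through its quotient [f] and its target subspace [b]; row l of [X] holds the
    coordinates of [h] at a lift of the l-th basis vector. Socle elements become matrices in this
    way. *)
Lemma factor_through_matrix (k : fieldType) (R : nzRingType)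
    (iota : {rmorphism k -> R}) (V W : lmodType R) t u
    (f : V -> 'rV[k]_t) (b : 'rV[k]_u -> W) (h : V -> W) :
  klinear iota f -> (forall p, exists x, f x = p) ->
  (forall c p q, b (c *: p + q) = iota c *: b p + b q) ->
  (forall c x y, h (iota c *: x + y) = iota c *: h x + h y) ->
  (forall x, f x = 0 -> h x = 0) -> (forall x, exists p, b p = h x) ->
  exists X : 'M[k]_(t, u), forall x, h x = b (f x *m X).
Proof.
move=> fL fs bL hL fh hb.
have /fin_all_exists[x xP] (l : 'I_t) : exists x, f x = delta_mx 0 l by apply: fs.
have /fin_all_exists[p pP] (l : 'I_t) : exists p, b p = h (x l) by apply: hb.
have hB y z : f y = f z -> h y = h z.
  move=> fyz; have hz : h (- z + y) = 0.
    by apply: fh; rewrite addrC (klinearB fL) fyz subrr.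
  have := hL 1 z (- z + y); rewrite rmorph1 !scale1r hz addr0 addrA subrr add0r.
  by [].
have h0 : h 0 = 0 by apply: fh; rewrite (klinear0 fL).
have b0 : b 0 = 0.
  by have := bL (-1) 0 0; rewrite scaler0 add0r rmorphN1 scaleN1r addNr.
have hsum (c : 'I_t -> k) (r : seq 'I_t) :
    h (\sum_(l <- r) iota (c l) *: x l) = b (\sum_(l <- r) c l *: p l).
  elim: r => [|l r IHr]; first by rewrite !big_nil h0 b0.
  by rewrite !big_cons hL bL IHr pP.
exists (\matrix_l p l) => y.
have -> : f y *m (\matrix_l p l) = \sum_l f y 0 l *: p l.
  by rewrite mulmx_sum_row; apply: eq_bigr => l _; rewrite rowK.
rewrite -hsum; apply: hB; rewrite (klinear_sum fL) [LHS]row_sum_delta.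
by apply: eq_bigr => l _; rewrite (klinearZ fL) xP.
Qed.

Lemma rank_one_left (k : fieldType) t u (p : 'rV[k]_t) (X : 'M[k]_(t, u)) :
  p != 0 -> (forall y : 'rV_t, y *m p^T = 0 -> y *m X = 0) ->
  exists q, X = p^T *m q.
Proof.
move=> p0 ker.
have [l pl] : exists l, p 0 l != 0.
  apply: contrapT => nl; case/eqP: p0; apply/rowP => l; rewrite mxE.
  by apply/eqP; apply: contrapT => /negP pl; apply: nl; exists l.
exists ((p 0 l)^-1 *: row l X); apply/row_matrixP => m.
(* This vector lies in the hyperplane orthogonal to [p], so row m of [X] is [p 0 m / p 0 l] times
   row l. *)
have := ker (p 0 l *: delta_mx 0 m - p 0 m *: delta_mx 0 l).
rewrite !mulmxBl -!scalemxAl -!rowE => /(_ _)/eqP.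
rewrite subr_eq0 => /(_ _)/eqP e; rewrite row_outer scalerA mulrC -scalerA -e.
  by rewrite scalerA mulVf // scale1r.
by apply/matrixP => i j; rewrite !ord1 !mxE mulrC subrr.
Qed.

Lemma rank_one_right (k : fieldType) t u (q : 'rV[k]_u) (X : 'M[k]_(t, u)) :
  (forall y : 'rV_t, exists c, y *m X = c *: q) -> exists p : 'rV_t, X = p^T *m q.
Proof.
move=> H; have /fin_all_exists[p pP] (l : 'I_t) : exists c, row l X = c *: q.
  by rewrite rowE; apply: H.
exists (\row_l p l); apply/row_matrixP => l.
by rewrite row_outer mxE pP.
Qed.

Lemma chain_length_le (T : Type) (L : set {pred T}) (mu : {pred T} -> nat) B c m :
  (forall P Q, L P -> L Q -> {subset P <= Q} -> (exists2 x, x \in Q & x \notin P) ->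
     (mu P < mu Q)%N) ->
  (forall P, L P -> (mu P <= B)%N) -> chain L c m -> (m <= B)%N.
Proof.
move=> muS muB [cL cS].
have le i : (i <= m)%N -> (i <= mu (c i))%N.
  elim: i => // i IHi im; apply: leq_ltn_trans (IHi (ltnW im)) _.
  have [sub str] := cS i im.
  by apply: muS => //; apply: cL => //; apply: ltnW.
exact: leq_trans (le m (leqnn m)) (muB _ (cL m (leqnn m))).
Qed.

Lemma is_length_bounded (T : Type) (L : set {pred T}) B :
  (exists P, L P) -> (forall c m, chain L c m -> (m <= B)%N) ->
  exists2 n, (n <= B)%N & is_length L n.
Proof.
move=> [P LP] bound; pose Q n := `[< exists c, chain L c n >].
have exQ : exists n, Q n by exists 0%N; apply/asboolP; exists (fun=> P); split.
have ubQ n : Q n -> (n <= B)%N by move=> /asboolP[c /bound].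
case: (ex_maxnP exQ ubQ) => n Qn maxn; exists n; first exact: ubQ.
split; first exact/asboolP.
by move=> c m cm; apply: maxn; apply/asboolP; exists c.
Qed.

Lemma sum_dim_lt (k : fieldType) (I : finType) (d : I -> nat)
    (U U' : forall i, {vspace 'rV[k]_(d i)}) :
  (forall i, (U i <= U' i)%VS) -> (exists i, ~~ (U' i <= U i)%VS) ->
  (\sum_i \dim (U i) < \sum_i \dim (U' i))%N.
Proof.
move=> UU' [i nU]; rewrite (bigD1 i) // [X in (_ < X)%N](bigD1 i) //=.
rewrite -addSn leq_add //; last by apply: leq_sum => j _; apply: dimvS.
rewrite ltnNge; apply: contra nU => dU.
by have := eqEdim (U i) (U' i); rewrite UU' dU => /eqP->; rewrite subvv.
Qed.

Lemma sum_dim_le (k : fieldType) (I : finType) (d : I -> nat)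
    (U : forall i, {vspace 'rV[k]_(d i)}) : (\sum_i \dim (U i) <= \sum_i d i)%N.
Proof.
apply: leq_sum => i _.
by rewrite (leq_trans (dimvS (subvf _))) // dimvf /dim /= mul1n.
Qed.

(** In a simple submodule, jz nonzero would generate z, so z = rjz for some r, and [jacobson_cancel]
    gives z = 0. *)
Lemma jacobson_mul_module_socle (k : fieldType) (R : nzRingType)
    (iota : {rmorphism k -> R}) (V : lmodType R) j (x : V) :
  finite_dim_left iota -> j \in @jacobson R -> x \in @socle R V -> j *: x = 0.
Proof.
move=> R_findim jJ /asboolP[s [sS ->]]; rewrite scaler_sumr big_seq big1 //.
move=> y /sS[U [_ sU] yU]; pose z : submod U := Submod yU.
suff : j *: z = 0 by move/(congr1 val).
apply: contrapT => jz.
pose P : {pred submod U} := fun w => `[< exists r : R, w = r *: (j *: z) >].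
have Pc : submod_closed P.
  split; first by apply/asboolP; exists 0; rewrite scale0r.
  move=> a _ _ /asboolP[r ->] /asboolP[r' ->]; apply/asboolP.
  by exists (a * r + r'); rewrite scalerDl scalerA.
have [P0|Pall] := sU (as_submod Pc).
  by apply/jz/P0/asboolP; exists 1; rewrite scale1r.
have /asboolP[r zE] := Pall z; apply: jz.
have /eqP -> : z \in (pred1 0 : {pred submod U}); last by rewrite scaler0.
apply: (jacobson_cancel R_findim (j := r * j)).
- by split=> [|a w w' /eqP-> /eqP->]; rewrite inE ?scaler0 ?addr0.
- exact: ((jacobson_closed R).2 r j jJ).1.
- by rewrite inE -scalerA -zE subrr.
Qed.

Lemma annihilator_ideal (R : nzRingType) (V : lmodType R) (P : {pred V}) :
  submod_closed P -> ideal_closed (fun r => `[< forall x, x \in P -> r *: x = 0 >]).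
Proof.
move=> [P0 PL]; split; first split.
- by apply/asboolP => x _; rewrite scale0r.
- move=> r r' /asboolP rP /asboolP rP'; apply/asboolP => x xP.
  by rewrite scalerBl rP // rP' // subrr.
move=> r r' /asboolP rP'; split; apply/asboolP => x xP; rewrite -scalerA.
  by rewrite rP' // scaler0.
by rewrite rP' // -[r *: x]addr0; apply: PL.
Qed.

Lemma transporter_ideal (R : nzRingType) (V : lmodType R) (P : {pred V}) :
  submod_closed P -> ideal_closed (fun r => `[< forall x, r *: x \in P >]).
Proof.
move=> [P0 PL]; split; first split.
- by apply/asboolP => x; rewrite scale0r.
- move=> r r' /asboolP rP /asboolP rP'; apply/asboolP => x.
  by rewrite scalerBl addrC -scaleN1r PL.
move=> r r' /asboolP rP'; split; apply/asboolP => x; rewrite -scalerA //.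
by rewrite -[r *: _]addr0; apply: PL.
Qed.

(* The e i lift primitive idempotents of R / J, one in each matrix block, and L
   writes 1 modulo J as a sum of terms F (e i) G. *)
Section Corners.
Variables (k : fieldType) (R : nzRingType) (iota : {rmorphism k -> R}).
Hypothesis R_findim : finite_dim_left iota.
Hypothesis iota_comm : forall c r, iota c * r - r * iota c \in @jacobson R.
Hypothesis iota_socle : forall c x, x \in @ring_socle R -> iota c * x = x * iota c.
Variables (I : finType) (e : I -> R) (L : seq (R * I * R)).
Hypothesis e_one : 1 - \sum_(l <- L) l.1.1 * e l.1.2 * l.2 \in @jacobson R.
Hypothesis e_diag : forall i r, exists c, e i * r * e i - iota c * e i \in @jacobson R.
Hypothesis e_off : forall i j r, i != j -> e i * r * e j \in @jacobson R.
Hypothesis e_idem : forall i, e i * e i - e i \in @jacobson R.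

Local Notation J := (@jacobson R).
Local Notation S := (@ring_socle R).

Lemma socle_congl r r' s : r - r' \in J -> s \in S -> r * s = r' * s.
Proof.
move=> rJ sS; apply/eqP; rewrite -subr_eq0 -mulrBl.
by rewrite (jacobson_mul_socle R_findim).
Qed.

Lemma socle_congr r r' s : r - r' \in J -> s \in S -> s * r = s * r'.
Proof.
move=> rJ sS; apply/eqP; rewrite -subr_eq0 -mulrBr.
by rewrite (socle_mul_jacobson R_findim).
Qed.

Lemma socleM r s : s \in S -> r * s \in S /\ s * r \in S.
Proof. exact: (ring_socle_ideal R).2. Qed.

(** Since 1 is modulo J a sum of terms F (e i) G, a submodule that absorbs J x contains x as soon as
    it contains all corners of x. *)
Lemma e_span (V : lmodType R) (Z : {pred V}) x : submod_closed Z ->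
  (forall j, j \in J -> j *: x \in Z) -> (forall i r, e i *: (r *: x) \in Z) ->
  x \in Z.
Proof.
move=> [Z0 ZL] xJ xe; rewrite -[x]scale1r -[1](subrK (\sum_(l <- L) l.1.1 * e l.1.2 * l.2)).
rewrite scalerDl -[X in X + _]scale1r; apply: (ZL); first exact: xJ.
rewrite scaler_suml; elim/big_rec: _ => // l y _ yZ.
by rewrite -!scalerA; apply: ZL.
Qed.

(** J kills the socle on both sides, so multiplying [s] left and right by the expansion of 1 modulo
    J leaves [s] unchanged; some term of the result is nonzero. *)
Lemma socle_corner s : s \in S -> s != 0 ->
  exists i r j r', e i * (r * s * r') * e j != 0.
Proof.
move=> sS s0; apply: contrapT => nz.
have nil i r j r' : e i * (r * s * r') * e j = 0.
  by apply/eqP; apply: contrapT => /negP h; apply: nz; exists i, r, j, r'.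
case/eqP: s0.
have right y : y \in S -> (forall j r', y * r' * e j = 0) -> y = 0.
  move=> yS y0; rewrite -[y]mulr1 (socle_congr e_one yS) mulr_sumr.
  by rewrite big1_seq // => l _; rewrite !mulrA y0 mul0r.
suff : (s : R^o) \in (pred1 0 : {pred R^o}) by rewrite inE => /eqP.
apply: e_span => [|j jJ|i r].
- by split=> [|a w w' /eqP-> /eqP->]; rewrite inE ?scaler0 ?addr0.
- by rewrite inE; apply/eqP; apply: (jacobson_mul_socle R_findim).
rewrite inE; apply/eqP; apply: right => [|j r'].
  exact: (socleM _ (socleM r sS).1).1.
by rewrite -[RHS](nil i r j r') -[e i *: _]/(e i * (r * s)) !mulrA.
Qed.

(** * A chain of ideals in the socle, built from independent corner elements *)

Section CornerChain.
Variables (T : finType) (a b : T -> I) (w : T -> R).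
Hypothesis wS : forall x, w x \in S.
Hypothesis we : forall x, e (a x) * w x * e (b x) = w x.
Hypothesis w_free : forall c : T -> k, \sum_x iota (c x) * w x = 0 ->
  forall x, c x = 0.

Definition corner_span (n : nat) : {pred R} := fun y =>
  `[< exists2 c : T -> k, forall x, (n <= enum_rank x)%N -> c x = 0 &
        y = \sum_x iota (c x) * w x >].

(** A condition on all corners, instead of the ideal generated by the first n elements [w x]:
    closure under multiplication is then immediate, and independence keeps the later [w x] out. *)
Definition corner_ideal (n : nat) : {pred R} := fun y => (y \in S) &&
  `[< forall i j r r', e i * (r * y * r') * e j \in corner_span n >].

Lemma corner_spanL n c y z :
  y \in corner_span n -> z \in corner_span n -> iota c * y + z \in corner_span n.
Proof.
move=> /asboolP[d d0 ->] /asboolP[d' d0' ->]; apply/asboolP.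
exists (fun x => c * d x + d' x) => [x nx|]; first by rewrite d0 // d0' // mulr0 addr0.
rewrite mulr_sumr -big_split; apply: eq_bigr => x _ /=.
by rewrite rmorphD rmorphM mulrDl mulrA.
Qed.

Lemma corner_span0 n : 0 \in corner_span n.
Proof.
apply/asboolP; exists (fun=> 0) => //.
by rewrite big1 // => x _; rewrite rmorph0 mul0r.
Qed.

Lemma corner_ideal_closed n : ideal_closed (corner_ideal n).
Proof.
have [[S0 SB] SM] := ring_socle_ideal R; split; first split.
- apply/andP; split=> //; apply/asboolP => i j r r'.
  by rewrite mulr0 mul0r mulr0 mul0r corner_span0.
- move=> y z /andP[yS /asboolP yP] /andP[zS /asboolP zP]; apply/andP.
  split; first exact: SB.
  apply/asboolP => i j r r'.
  have -> : e i * (r * (y - z) * r') * e j =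
      iota (-1) * (e i * (r * z * r') * e j) + e i * (r * y * r') * e j.
    by rewrite rmorphN1 mulN1r [RHS]addrC mulrBr mulrBl mulrBr mulrBl.
  exact: corner_spanL.
move=> r0 y /andP[yS /asboolP yP]; split; apply/andP; split.
- exact: (SM r0 y yS).1.
- by apply/asboolP => i j r r'; have := yP i j (r * r0) r'; rewrite !mulrA.
- exact: (SM r0 y yS).2.
- by apply/asboolP => i j r r'; have := yP i j r (r0 * r'); rewrite !mulrA.
Qed.

(** A corner of r (w x) r' outside the position of [w x] has a factor in J next to a socle element,
    so it vanishes. At that position r and r' act as scalars c and c', and c' moves to the left
    because [k] centralizes the socle. *)
Lemma corner_ideal_mem n x : (enum_rank x < n)%N -> w x \in corner_ideal n.
Proof.
move=> xn; apply/andP; split=> //; apply/asboolP => i j r r'.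
rewrite -[w x]we; have [ia|ia] := eqVneq i (a x); last first.
  have -> : e i * (r * (e (a x) * w x * e (b x)) * r') * e j =
      (e i * r * e (a x)) * w x * (e (b x) * r' * e j) by rewrite !mulrA.
  by rewrite (jacobson_mul_socle R_findim (e_off _ ia)) // mul0r corner_span0.
have [jb|jb] := eqVneq (b x) j; last first.
  have -> : e i * (r * (e (a x) * w x * e (b x)) * r') * e j =
      (e i * r * e (a x)) * (w x * (e (b x) * r' * e j)) by rewrite !mulrA.
  by rewrite (socle_mul_jacobson R_findim (e_off _ jb)) // mulr0 corner_span0.
have [c cP] := e_diag (a x) r; have [c' cP'] := e_diag (b x) r'.
have -> : e i * (r * (e (a x) * w x * e (b x)) * r') * e j =
    iota (c * c') * w x + 0.
  rewrite ia -jb addr0.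
  transitivity ((e (a x) * r * e (a x)) * (w x * (e (b x) * r' * e (b x)))).
    by rewrite !mulrA.
  have wbS : w x * e (b x) \in S by apply: (socleM _ (wS x)).2.
  have -> : w x * (e (b x) * r' * e (b x)) = iota c' * (w x * e (b x)).
    by rewrite (socle_congr cP' (wS x)) [RHS]mulrA (iota_socle _ (wS x)) mulrA.
  rewrite (socle_congl cP (socleM _ wbS).1) -mulrA rmorphM -mulrA; congr (_ * _).
  rewrite mulrA -(socle_congl (iota_comm c' (e (a x))) wbS).
  by rewrite -mulrA [e _ * (_ * _)]mulrA we.
apply: corner_spanL; last exact: corner_span0.
apply/asboolP; exists (fun y => (y == x)%:R) => [y ny|].
  by case: eqP ny => // ->; rewrite leqNgt xn.
rewrite (bigD1 x) //= eqxx rmorph1 mul1r big1 ?addr0 // => y /negPf->.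
by rewrite rmorph0 mul0r.
Qed.

Lemma corner_ideal_notin n x : (n <= enum_rank x)%N -> w x \notin corner_ideal n.
Proof.
move=> nx; apply/negP => /andP[_ /asboolP/(_ (a x) (b x) 1 1)].
rewrite mul1r mulr1 we => /asboolP[c c0 wE].
have : \sum_y iota (c y - (y == x)%:R) * w y = 0.
  transitivity (\sum_y iota (c y) * w y - \sum_y iota (y == x)%:R * w y).
    rewrite -sumrB; apply: eq_bigr => y _.
    by rewrite rmorphB mulrBl.
  rewrite -wE [X in _ - X](bigD1 x) //= eqxx rmorph1 mul1r big1 ?addr0 ?subrr // => y /negPf->.
  by rewrite rmorph0 mul0r.
move=> /w_free/(_ x); rewrite c0 // eqxx => /eqP.
by rewrite sub0r oppr_eq0 oner_eq0.
Qed.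

Lemma corner_chain : chain
  [set K : {pred R} | ideal_closed K /\ {subset K <= S}] corner_ideal #|T|.
Proof.
split=> [n _|n nT].
  by split; [apply: corner_ideal_closed | move=> y /andP[]].
split.
  move=> y /andP[yS /asboolP yP]; apply/andP; split=> //.
  apply/asboolP => i j r r'; have /asboolP[c c0 ->] := yP i j r r'.
  by apply/asboolP; exists c => // x /ltnW; apply: c0.
exists (w (enum_val (Ordinal nT))).
  by apply: corner_ideal_mem; rewrite enum_valK.
by apply: corner_ideal_notin; rewrite enum_valK.
Qed.

Lemma corner_length : exists2 n, (#|T| <= n)%N & bimodule_length S n.
Proof.
have [n [d dP]] := kdimension (regular_kspanned R_findim).
have kc (K : {pred R}) : ideal_closed K -> kclosed iota (K : {pred R^o}).
  by move=> Kc; apply/submod_kclosed/ideal_submod.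
have [||N _ NP] := @is_length_bounded R
    [set K : {pred R} | ideal_closed K /\ {subset K <= S}] n.
- by exists S; split=> //; apply: ring_socle_ideal.
- move=> c m; apply: (chain_length_le (mu := d)) => [P Q [Pc PS] [Qc QS] PQ [y yQ yP]|P [Pc _]].
    have [dPQ _ h] := dP P Q (kc P Pc) (kc Q Qc) PQ.
    rewrite ltn_neqAle dPQ andbT; apply: contra yP => /eqP dE.
    by apply: h => //; rewrite dE.
  by have [] := dP P P (kc P Pc) (kc P Pc) (fun x => id).
by exists N => //; apply: NP.2 corner_chain.
Qed.

End CornerChain.

(** * Socle elements as matrices between the corners of M *)

Section MinimalFaithful.
Variable M : lmodType R.
Hypothesis M_faithful : faithful M.
Hypothesis M_sub : forall P : {pred M}, submod_closed P -> (exists x, x \notin P) ->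
  exists s, [/\ s \in S, s != 0 & forall x, x \in P -> s *: x = 0].
Hypothesis M_quot : forall P : {pred M}, submod_closed P ->
  (exists2 x, x \in P & x != 0) ->
  exists s, [/\ s \in S, s != 0 & forall x, s *: x \in P].

Local Notation JM := (@jacobson_smul R M).

Lemma JM_mem j x : j \in J -> j *: x \in JM.
Proof.
move=> jJ; apply/asboolP; exists [:: j *: x]; rewrite big_seq1; split=> // y.
by rewrite inE => /eqP->; exists j => //; exists x.
Qed.

Lemma JM_closed : submod_closed JM.
Proof. exact: jacobson_smul_closed. Qed.

Lemma JM_lin a x y : x \in JM -> y \in JM -> a *: x + y \in JM.
Proof. exact: JM_closed.2. Qed.

Lemma JM_cong r r' x : r - r' \in J -> (r *: x \in JM) = (r' *: x \in JM).
Proof.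
move=> rJ; have h := JM_mem x rJ; rewrite scalerBl in h; apply/idP/idP => m.
  by have := JM_lin (-1) h m; rewrite scaleN1r opprB subrK.
by have := JM_lin 1 h m; rewrite scale1r subrK.
Qed.

Lemma socle_kills_JM s z : s \in S -> z \in JM -> s *: z = 0.
Proof.
move=> sS /asboolP[r [rP ->]]; rewrite scaler_sumr big_seq big1 // => y /rP.
by move=> [j jJ [x ->]]; rewrite scalerA (socle_mul_jacobson R_findim) ?scale0r.
Qed.

(* corner_top i is the kernel of the multiplication by e i on M / J M, and
   corner_bot i is e i times the annihilator of J in M, which contains the socle;
   the coordinates al i and be i below parametrise e i (M / J M) and corner_bot i. *)
Definition corner_top i : {pred M} := fun x => e i *: x \in JM.

Definition corner_bot i : {pred M} := fun x =>
  `[< (forall j, j \in J -> j *: x = 0) /\ e i *: x = x >].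

Lemma corner_top_kclosed i : kclosed iota (corner_top i).
Proof.
split=> [|c x y xT yT]; first by rewrite /in_mem /= /corner_top scaler0 JM_closed.1.
rewrite /in_mem /= /corner_top scalerDr scalerA -[e i *: y]scale1r addrC.
apply: JM_lin => //.
have h : e i * iota c - iota c * e i \in J.
  by rewrite -opprB rpredN.
by rewrite (JM_cong x h) -scalerA -[_ *: _]addr0 JM_lin // JM_closed.1.
Qed.

Lemma corner_bot_kclosed i : kclosed iota (corner_bot i).
Proof.
split=> [|c x y /asboolP[xJ xe] /asboolP[yJ ye]]; apply/asboolP; split.
- by move=> j _; rewrite scaler0.
- by rewrite scaler0.
- move=> j jJ; rewrite scalerDr yJ // addr0 scalerA xJ //.
  exact: ((jacobson_closed R).2 (iota c) j jJ).2.
rewrite scalerDr ye scalerA; congr (_ + _); rewrite -{2}xe scalerA.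
apply/eqP; rewrite -subr_eq0 -scalerBl xJ // -opprB rpredN.
exact: iota_comm.
Qed.

Section Coordinates.
Variables (t u : I -> nat) (al : forall i, M -> 'rV[k]_(t i))
  (be : forall i, 'rV[k]_(u i) -> M).
Hypothesis al_lin : forall i, klinear iota (@al i).
Hypothesis al0 : forall i x, al i x = 0 <-> e i *: x \in JM.
Hypothesis al_surj : forall i p, exists x, al i x = p.
Hypothesis be_lin : forall i c p q, be (c *: p + q) = iota c *: @be i p + be q.
Hypothesis be_inj : forall i p, @be i p = 0 -> p = 0.
Hypothesis be_im : forall i x, x \in corner_bot i <-> exists p, @be i p = x.

Lemma be0 i : @be i 0 = 0.
Proof. by have := be_lin (-1) (0 : 'rV[k]_(u i)) 0; rewrite scaler0 add0r rmorphN1 scaleN1r addNr. Qed.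

Lemma beZ i c p : @be i (c *: p) = iota c *: be p.
Proof. by rewrite -[c *: p]addr0 be_lin be0 addr0. Qed.

Lemma be_injective i p q : @be i p = be q -> p = q.
Proof.
move=> pq; apply/eqP; rewrite -subr_eq0; apply/eqP/be_inj.
by rewrite addrC -scaleN1r be_lin pq rmorphN1 scaleN1r addNr.
Qed.

Lemma al_corner i r c x : e i * r * e i - iota c * e i \in J ->
  al i (r *: (e i *: x)) = c *: al i x.
Proof.
move=> cJ; apply/eqP; rewrite -subr_eq0 -(klinearZ (@al_lin i)) -(klinearB (@al_lin i)).
apply/eqP/al0.
(* The second bracket corrects for [iota c] commuting with [e i] only modulo J. *)
have -> : e i *: (r *: (e i *: x) - iota c *: x) =
    ((e i * r * e i - iota c * e i) + (iota c * e i - e i * iota c)) *: x.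
  by rewrite addrA subrK scalerBr !scalerA mulrA -scalerBl.
by apply: JM_mem; apply: rpredD.
Qed.

Lemma al_off i j r x : i != j -> al i (r *: (e j *: x)) = 0.
Proof. by move=> ij; apply/al0; rewrite !scalerA JM_mem ?e_off. Qed.

Lemma be_corner i r c p : e i * r * e i - iota c * e i \in J ->
  e i *: (r *: be p) = @be i (c *: p).
Proof.
move=> cJ; have /asboolP[pJ pe] : be p \in corner_bot i by apply/be_im; exists p.
rewrite beZ -{1 2}pe !scalerA; apply/eqP.
by rewrite -subr_eq0 -scalerBl pJ.
Qed.

Lemma be_off i j r p : i != j -> e i *: (r *: @be j p) = 0.
Proof.
move=> ij; have /asboolP[pJ <-] : be p \in corner_bot j by apply/be_im; exists p.
by rewrite !scalerA pJ // e_off.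
Qed.

(** [X] is the matrix, acting on row vectors, of the map from e_j (M / J M) to e_i ann_M(J) induced
    by e_i s e_j. *)
Definition acts i j s (X : 'M[k]_(t j, u i)) : Prop :=
  forall x, (e i * s * e j) *: x = be (al j x *m X).

Lemma corner_socle i j s : s \in S -> e i * s * e j \in S.
Proof. by move=> sS; apply: (socleM _ (socleM _ sS).1).2. Qed.

Lemma corner_idl i j s : s \in S -> e i * (e i * s * e j) = e i * s * e j.
Proof.
move=> sS; rewrite !mulrA; congr (_ * _).
exact: socle_congl (e_idem i) sS.
Qed.

Lemma corner_idr i j s : s \in S -> (e i * s * e j) * e j = e i * s * e j.
Proof.
move=> sS; rewrite -mulrA; apply: socle_congr (e_idem j) _.
exact: (socleM _ sS).1.
Qed.

Lemma acts_exists i j s : s \in S -> exists X, @acts i j s X.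
Proof.
move=> sS; have gS := corner_socle i j sS.
apply: (factor_through_matrix (h := fun x => (e i * s * e j) *: x)
  (@al_lin j) (@al_surj j) (@be_lin i)) => [c x y|x /al0 xJ|x].
- by rewrite scalerDr scalerA -iota_socle // scalerA.
- by rewrite -scalerA socle_kills_JM // (socleM _ sS).1.
apply/be_im/asboolP; split=> [l lJ|].
  by rewrite scalerA (jacobson_mul_socle R_findim) ?scale0r.
by rewrite scalerA corner_idl.
Qed.

Lemma acts_lin i j c s s' X X' : s \in S ->
  @acts i j s X -> @acts i j s' X' -> @acts i j (iota c * s + s') (c *: X + X').
Proof.
move=> sS sX sX' x; rewrite mulmxDr -scalemxAr be_lin -sX -sX' scalerA -scalerDl.
congr (_ *: _); rewrite mulrDr mulrDl; congr (_ + _).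
by rewrite !mulrA; congr (_ * _); rewrite (socle_congl (iota_comm c (e i)) sS).
Qed.

(** Faithfulness of M makes the matrix determine the corner e_i s e_j. Hence the edges of the graph
    are visible in the spaces of matrices. *)
Lemma acts_eq0 i j s X : @acts i j s X -> (X = 0 <-> e i * s * e j = 0).
Proof.
move=> sX; split=> [X0|g0].
  by apply: M_faithful => x; rewrite sX X0 mulmx0 be0.
apply/row_matrixP => l; rewrite row0 rowE.
have [x <-] := al_surj (delta_mx 0 l); apply: (@be_inj i).
by rewrite -sX g0 scale0r.
Qed.

Definition act_space i j : {pred 'M[k]_(t j, u i)} :=
  fun X => `[< exists2 s, s \in S & @acts i j s X >].

Lemma act_space_closed i j : submod_closed (@act_space i j).
Proof.
split=> [|c X X' /asboolP[s sS sX] /asboolP[s' sS' sX']]; apply/asboolP.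
  exists 0; first exact: (ring_socle_ideal R).1.1.
  by move=> x; rewrite mulr0 mul0r scale0r mulmx0 be0.
exists (iota c * s + s'); last exact: acts_lin.
have [[_ SB] SM] := ring_socle_ideal R.
rewrite -[s']opprK; apply: SB; first exact: (SM _ _ sS).1.
by rewrite -mulN1r; apply: (SM _ _ sS').1.
Qed.

(** [N] is the largest submodule whose j-coordinates are orthogonal to [p]. It is proper, so a
    nonzero socle element kills it. [N] contains e_j' M for every j' other than j, so a nonzero
    corner of that element starts at j; its matrix vanishes on the hyperplane, hence has the form
    [p^T *m q]. *)
Lemma act_space_left j (p : 'rV[k]_(t j)) : p != 0 ->
  exists i, exists2 q : 'rV_(u i), q != 0 & p^T *m q \in @act_space i j.
Proof.
move=> p0.
pose N : {pred M} := fun x => `[< forall r, al j (r *: x) *m p^T = 0 >].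
have Nc : submod_closed N.
  split=> [|a x y /asboolP xN /asboolP yN]; apply/asboolP => r.
    by rewrite scaler0 (klinear0 (@al_lin j)) mul0mx.
  by rewrite scalerDr (klinearD (@al_lin j)) scalerA mulmxDl xN yN addr0.
have [|s0 [s0S s00 s0N]] := M_sub Nc.
  have [l pl] : exists l, p 0 l != 0.
    apply: contrapT => nl; case/eqP: p0; apply/rowP => l; rewrite mxE.
    by apply/eqP; apply: contrapT => /negP pl; apply: nl; exists l.
  have [x xl] := al_surj (delta_mx 0 l); exists x.
  apply/negP => /asboolP/(_ 1); rewrite scale1r xl -rowE => /rowP/(_ 0).
  by rewrite !mxE => /eqP; rewrite (negPf pl).
have [i [r [j' [r' g0]]]] := socle_corner s0S s00.
pose s := r * s0 * r'; have sS : s \in S by apply: (socleM _ (socleM _ s0S).1).2.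
have sN x : x \in N -> s *: x = 0.
  move=> xN; rewrite -!scalerA s0N ?scaler0 //.
  by rewrite -[_ *: _]addr0; apply: Nc.2 => //; apply: Nc.1.
have jj : j' = j.
  apply: contrapT => /eqP jj; case/eqP: g0; apply: M_faithful => x.
  rewrite -/s -scalerA -scalerA sN ?scaler0 //; apply/asboolP => r0.
  by rewrite al_off ?mul0mx // eq_sym.
rewrite {j'}jj -/s in g0.
have [X sX] := acts_exists i j sS.
have X0 : X != 0 by apply: contraNneq g0 => /(acts_eq0 sX) ->.
have [|q XE] := rank_one_left (X := X) p0.
  move=> y yp; have [x xy] := al_surj y; apply: (@be_inj i).
  rewrite -xy -sX -scalerA -scalerA sN ?scaler0 //; apply/asboolP => r0.
  by have [c cP] := e_diag j r0; rewrite (al_corner _ cP) xy -scalemxAl yp scaler0.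
exists i, q; last by apply/asboolP; exists s => //; rewrite -XE.
by apply: contraNneq X0 => q0; rewrite XE q0 mulmx0.
Qed.

(** Dually, some nonzero socle element maps M into the submodule generated by the vector [v] of [q].
    The i-corner of that submodule is the line of [v] and its other corners vanish, so a nonzero
    corner of the socle element ends at i and has the line of [q] as its image. *)
Lemma act_space_right i (q : 'rV[k]_(u i)) : q != 0 ->
  exists j, exists2 p : 'rV_(t j), p != 0 & p^T *m q \in @act_space i j.
Proof.
move=> q0; pose v := be q.
pose N : {pred M} := fun x => `[< exists r : R, x = r *: v >].
have Nc : submod_closed N.
  split=> [|a x y /asboolP[r ->] /asboolP[r' ->]]; apply/asboolP.
    by exists 0; rewrite scale0r.
  by exists (a * r + r'); rewrite scalerDl scalerA.
have [|s0 [s0S s00 s0N]] := M_quot Nc.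
  exists v; first by apply/asboolP; exists 1; rewrite scale1r.
  by apply: contraNneq q0 => /be_inj ->.
have [i' [r [j [r' g0]]]] := socle_corner s0S s00.
pose s := r * s0 * r'; have sS : s \in S by apply: (socleM _ (socleM _ s0S).1).2.
have sN x : exists r0, s *: x = r0 *: v.
  have /asboolP[r0 r0E] := s0N (r' *: x).
  by exists (r * r0); rewrite -!scalerA r0E.
have ii : i' = i.
  apply: contrapT => /eqP ii; case/eqP: g0; apply: M_faithful => x.
  rewrite -/s -scalerA -scalerA; have [r0 ->] := sN (e j *: x).
  exact: be_off.
rewrite {i'}ii -/s in g0.
have [X sX] := acts_exists i j sS.
have X0 : X != 0 by apply: contraNneq g0 => /(acts_eq0 sX) ->.
have [|p XE] := rank_one_right (q := q) (X := X).
  move=> y; have [x <-] := al_surj y.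
  have [r0 r0E] := sN (e j *: x); have [c cP] := e_diag i r0; exists c.
  by apply: be_injective; rewrite -sX -scalerA -scalerA r0E (be_corner _ cP).
exists j, p; last by apply/asboolP; exists s => //; rewrite -XE.
by apply: contraNneq X0 => p0; rewrite XE p0 trmx0 mul0mx.
Qed.

Lemma be_sum i (T : Type) (r : seq T) (c : T -> k) (p : T -> 'rV[k]_(u i)) :
  be (\sum_(l <- r) c l *: p l) = \sum_(l <- r) iota (c l) *: be (p l).
Proof.
elim: r => [|l r IHr]; first by rewrite !big_nil be0.
by rewrite !big_cons be_lin IHr.
Qed.

(** Bases of all the [D i j] lift to corner elements of the socle that are jointly independent over
    [k], which is what [corner_length] needs. *)
Lemma corner_socle_length (D : forall i j, {vspace 'M[k]_(t j, u i)}) :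
  (forall i j, D i j =i @act_space i j) ->
  exists2 n, (\sum_(ij : I * I) \dim (D ij.1 ij.2) <= n)%N & bimodule_length S n.
Proof.
move=> DE; pose T := {ij : I * I & 'I_(\dim (D ij.1 ij.2))}.
pose tg ab m : T := Tagged (fun ab => 'I_(\dim (D ab.1 ab.2))) (m : 'I_(\dim (D ab.1 ab.2))).
pose X (x : T) := (vbasis (D (tag x).1 (tag x).2))`_(tagged x).
have /fin_all_exists[s sP] (x : T) : exists s,
    s \in S /\ @acts (tag x).1 (tag x).2 s (X x).
  have : X x \in D (tag x).1 (tag x).2 by apply/vbasis_mem/mem_nth; rewrite size_tuple.
  by rewrite DE => /asboolP[s sS sX]; exists s.
pose w x := e (tag x).1 * s x * e (tag x).2.
have [||c c0 x|n nT nL] := @corner_length T (fun x => (tag x).1) (fun x => (tag x).2) w.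
- by move=> x; apply: corner_socle (sP x).1.
- by move=> x; rewrite corner_idl ?corner_idr // (sP x).1.
- case: x => ij l.
  (* Multiplying a linear relation by the two idempotents isolates its part in the corner [ij]. *)
  have proj (y : T) : e ij.1 * (iota (c y) * w y) * e ij.2 =
      if tag y == ij then iota (c y) * w y else 0.
    have wS : w y \in S := corner_socle _ _ (sP y).1.
    have slide z d : z \in S ->
        e ij.1 * (iota d * z) * e ij.2 = iota d * (e ij.1 * z * e ij.2).
      move=> zS; rewrite !mulrA; congr (_ * _).
      by rewrite (socle_congl (iota_comm d (e ij.1)) zS).
    rewrite slide //.
    case: eqP => [<-|ne]; first by rewrite corner_idl ?corner_idr // (sP y).1.
    have [a|a] := eqVneq ij.1 (tag y).1; last first.
      have -> : e ij.1 * w y * e ij.2 =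
          (e ij.1 * 1 * e (tag y).1) * (s y * (e (tag y).2 * e ij.2)).
        by rewrite /w mulr1 !mulrA.
      rewrite (jacobson_mul_socle R_findim (e_off _ a)) ?mulr0 //.
      exact: (socleM _ (sP y).1).2.
    have [b|b] := eqVneq (tag y).2 ij.2; last first.
      have -> : e ij.1 * w y * e ij.2 =
          (e ij.1 * (e (tag y).1 * s y)) * (e (tag y).2 * 1 * e ij.2).
        by rewrite /w mulr1 !mulrA.
      rewrite (socle_mul_jacobson R_findim (e_off _ b)) ?mulr0 //.
      exact: (socleM _ (socleM _ (sP y).1).1).1.
    by case: ne; rewrite [LHS]surjective_pairing -a b -surjective_pairing.
  have c0' : \sum_y (if tag y == ij then iota (c y) * w y else 0) = 0.
    rewrite -(eq_bigr _ (fun y _ => proj y)) -mulr_suml -mulr_sumr c0.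
    by rewrite mulr0 mul0r.
  (* [G] takes the corner and the basis index separately, so that the sum over the sigma type [T]
     splits into a double sum. *)
  pose G (ab : I * I) (m : 'I_(\dim (D ab.1 ab.2))) : R :=
    if ab == ij then iota (c (tg ab m)) * w (tg ab m) else 0.
  have {}c0' : \sum_m iota (c (tg ij m)) * w (tg ij m) = 0.
    have GE : \sum_m G ij m = 0; last first.
      by rewrite -[RHS]GE; apply: eq_bigr => m _; rewrite /G eqxx.
    rewrite -[RHS]c0' (eq_bigr (fun y : T => G (tag y) (tagged y))); last first.
      by case=> ab m _.
    rewrite -(sig_big_dep xpredT (fun _ => xpredT) G) /= (bigD1 ij) //=.
    by rewrite [X in _ = _ + X]big1 ?addr0 // => ab /negPf ab0; rewrite big1 // => m _; rewrite /G ab0.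
  have fX : free (vbasis (D ij.1 ij.2)) := basis_free (vbasisP _).
  move/freeP: fX => /(_ (fun m => c (tg ij m)))/(_ _ l); apply.
  apply/row_matrixP => m.
  rewrite row0 rowE; have [x <-] := al_surj (delta_mx 0 m); apply: (@be_inj ij.1).
  rewrite mulmx_sumr; under eq_bigr do rewrite -scalemxAr.
  rewrite be_sum -[RHS](scale0r x) -c0' scaler_suml; apply: eq_bigr => q _.
  rewrite -scalerA; congr (_ *: _).
  by rewrite (sP (tg ij q)).2.
exists n => //; apply: leq_trans nT.
rewrite card_tagged sumnE big_map big_enum /=.
by apply/eq_leq/eq_bigr => ij _; rewrite card_ord.
Qed.

(** A submodule of M / J M is measured by the dimensions of its traces in the corners. By [e_span]
    these traces determine it, so each strict step of a chain raises their sum. *)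
Lemma top_length : exists2 a, (a <= \sum_i t i)%N &
  module_length (quotmod (@jacobson_smul R M)) a.
Proof.
pose Q := quotmod (@jacobson_smul R M).
pose pi : M -> Q := @quotmod_pi R M (@jacobson_smul R M).
have piZ r x : pi (r *: x) = r *: pi x by apply: quotmod_piZ.
have piD x y : pi (x + y) = pi x + pi y by apply: quotmod_piD.
have piK (q : Q) : exists x, pi x = q by exists (repr q); apply: quotmod_piK.
have pi_eq x y : (pi x = pi y) <-> (x - y \in JM) by apply: quotmod_piP.
have pi0 : pi 0 = 0 by apply: (addrI (pi 0)); rewrite -piD !addr0.
have piJ x : x \in JM -> pi x = 0.
  by move=> xJ; rewrite -pi0; apply/pi_eq; rewrite subr0.
have /choice[U UE] (P : {pred Q}) : exists U : forall i, {vspace 'rV[k]_(t i)},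
    submod_closed P -> forall i p, (p \in U i) <-> exists2 x, pi x \in P & al i x = p.
  have [Pc|nPc] := pselect (submod_closed P); last by exists (fun=> 0%VS).
  have /fin_all_exists[U UE] i : exists U : {vspace 'rV[k]_(t i)},
      forall p, (p \in U) <-> exists2 x, pi x \in P & al i x = p.
    pose A : {pred 'rV[k]_(t i)} := fun p => `[< exists2 x, pi x \in P & al i x = p >].
    have [|U UE] := @closed_vspace k _ A.
      split=> [|c p q /asboolP[x xP <-] /asboolP[y yP <-]]; apply/asboolP.
        by exists 0; rewrite ?pi0 ?Pc.1 // (klinear0 (@al_lin i)).
      exists (iota c *: x + y); last exact: al_lin.
      by rewrite piD piZ Pc.2.
    by exists U => p; rewrite UE; split=> /asboolP.
  by exists U => _.
have [||n nle nL] := @is_length_bounded Q [set P : {pred Q} | submod_closed P] (\sum_i t i).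
- by exists (predT : {pred Q}); split.
- move=> c m; apply: (chain_length_le (mu := fun P => (\sum_i \dim (U P i))%N)); last first.
    by move=> P _; apply: sum_dim_le.
  move=> P P' Pc P'c PP' [y yP' yP]; apply: sum_dim_lt => [i|].
    apply/subvP => p /(UE P Pc)[x xP <-]; apply/(UE P' P'c).
    by exists x => //; apply: PP'.
  apply: contrapT => nU; case/negP: yP; apply: e_span => // [j jJ|i r].
    by have [x <-] := piK y; rewrite -piZ piJ ?JM_mem //; apply: Pc.1.
  have [x xE] := piK y.
  have : al i (r *: x) \in U P' i.
    apply/(UE P' P'c); exists (r *: x) => //.
    by rewrite piZ xE -[_ *: _]addr0 P'c.2 // P'c.1.
  have [UP|/negP UP] := boolP (U P' i <= U P i)%VS; last by case: nU; exists i; apply/negP.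
  move=> /(subvP UP)/(UE P Pc)[x' x'P ax].
  have -> : e i *: (r *: y) = e i *: pi x' + 0.
    rewrite addr0 -xE -!piZ; apply/pi_eq; rewrite -scalerBr; apply/al0.
    by rewrite (klinearB (@al_lin i)) ax subrr.
  by apply: Pc.2 => //; apply: Pc.1.
by exists n.
Qed.

(** The same measure works on the socle: J kills it, so its corners lie in [corner_bot] and have
    coordinates through [be]. *)
Lemma bottom_length : exists2 b, (b <= \sum_i u i)%N &
  module_length (submod (@socle R M)) b.
Proof.
pose W := submod (@socle R M).
have WJ (y : W) j : j \in J -> j *: val y = 0.
  by move=> jJ; apply: (jacobson_mul_module_socle R_findim jJ); apply: valP.
have /choice[U UE] (P : {pred W}) : exists U : forall i, {vspace 'rV[k]_(u i)},
    submod_closed P -> forall i p, (p \in U i) <-> exists2 y, y \in P & be p = val y.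
  have [Pc|nPc] := pselect (submod_closed P); last by exists (fun=> 0%VS).
  have /fin_all_exists[U UE] i : exists U : {vspace 'rV[k]_(u i)},
      forall p, (p \in U) <-> exists2 y, y \in P & be p = val y.
    pose A : {pred 'rV[k]_(u i)} := fun p => `[< exists2 y, y \in P & be p = val y >].
    have [|U UE] := @closed_vspace k _ A.
      split=> [|c p q /asboolP[x xP px] /asboolP[y yP qy]]; apply/asboolP.
        by exists 0; rewrite ?Pc.1 // be0.
      by exists (iota c *: x + y); [apply: Pc.2 | rewrite be_lin px qy].
    by exists U => p; rewrite UE; split=> /asboolP.
  by exists U => _.
have [||n nle nL] := @is_length_bounded W [set P : {pred W} | submod_closed P] (\sum_i u i).
- by exists (predT : {pred W}); split.
- move=> c m; apply: (chain_length_le (mu := fun P => (\sum_i \dim (U P i))%N)); last first.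
    by move=> P _; apply: sum_dim_le.
  move=> P P' Pc P'c PP' [y yP' yP]; apply: sum_dim_lt => [i|].
    apply/subvP => p /(UE P Pc)[x xP px]; apply/(UE P' P'c).
    by exists x => //; apply: PP'.
  apply: contrapT => nU; case/negP: yP; apply: e_span => // [j jJ|i r].
    suff -> : j *: y = 0 by apply: Pc.1.
    by apply: val_inj; rewrite /= WJ.
  have zP' : e i *: (r *: y) \in P'.
    by rewrite scalerA -[_ *: _]addr0 P'c.2 // P'c.1.
  have /be_im[p pE] : val (e i *: (r *: y)) \in corner_bot i.
    apply/asboolP; split=> [j|]; first exact: WJ.
    have -> : val (e i *: (r *: y)) = e i *: val (r *: y) by [].
    by rewrite scalerA; apply/eqP; rewrite -subr_eq0 -scalerBl WJ.
  have : p \in U P' i by apply/(UE P' P'c); exists (e i *: (r *: y)).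
  have [UP|/negP UP] := boolP (U P' i <= U P i)%VS; last by case: nU; exists i; apply/negP.
  move=> /(subvP UP)/(UE P Pc)[z zP pz].
  suff -> : e i *: (r *: y) = z by [].
  by apply: val_inj; rewrite -pz -pE.
by exists n.
Qed.

End Coordinates.
Lemma corner_inequality : (forall s : seq k, exists c, c \notin s) ->
  kspanned iota M ->
  let nz i j := `[< exists2 s, s \in S & e i * s * e j != 0 >] in
  exists a b c, [/\ module_length (quotmod (@jacobson_smul R M)) a,
    module_length (submod (@socle R M)) b, bimodule_length S c &
    (a + b + #|[set ij : I * I | nz ij.1 ij.2]| <=
     c + (#|[set i | [exists j, nz i j]]| + #|[set j | [exists i, nz i j]]|))%N].
Proof.
move=> fresh Mk nz.
have /fin_all_exists[t /fin_all_exists[al alP]] i :=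
  quotient_coordinates Mk (corner_top_kclosed i).
have /fin_all_exists[u /fin_all_exists[be beP]] i :=
  subspace_coordinates Mk (corner_bot_kclosed i).
have al_lin i : klinear iota (al i) by have [] := alP i.
have al0 i x : al i x = 0 <-> e i *: x \in JM by have [_ + _] := alP i; apply.
have al_surj i p : exists x, al i x = p by have [_ _] := alP i; apply.
have be_lin i c p q : be i (c *: p + q) = iota c *: be i p + be i q.
  by have [+ _ _] := beP i; apply.
have be_inj i p : be i p = 0 -> p = 0 by have [_ + _] := beP i; apply.
have be_im i x : x \in corner_bot i <-> exists p, be i p = x.
  by have [_ _] := beP i; apply.
have DX i j : exists U : {vspace 'M[k]_(t j, u i)}, U =i act_space al be (i:=i) (j:=j).
  exact/closed_vspace/(act_space_closed al be_lin).
have /fin_all_exists[D DE] i := fin_all_exists (DX i).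
have [c cD cL] := corner_socle_length al_surj be_lin be_inj DE.
have [a aT aL] := top_length al_lin al0.
have [b bU bL] := bottom_length be_lin be_im.
exists a, b, c; split=> //.
have core := @vertex_edge_count k fresh I t u D.
have nzE i j : (D i j != 0%VS) = nz i j.
  apply/idP/asboolP => [D0|[s sS g0]].
    have [X XD X0] : exists2 X, X \in D i j & X != 0.
      apply: contrapT => nX; case/negP: D0; rewrite -subv0; apply/subvP => X XD.
      rewrite memv0; apply/eqP/eqP; apply: contrapT => /negP X0.
      by apply: nX; exists X.
    move: XD; rewrite DE => /asboolP[s sS sX]; exists s => //.
    by apply: contraNneq X0 => /(acts_eq0 al_surj be_lin be_inj sX) ->.
  have [X sX] := acts_exists al_lin al0 al_surj be_lin be_im i j sS.
  have XD : X \in D i j by rewrite DE; apply/asboolP; exists s.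
  apply: contraNneq g0 => D0; apply/eqP/(acts_eq0 al_surj be_lin be_inj sX).
  by apply/eqP; rewrite -memv0 -D0.
have {}core : (\sum_j t j + \sum_i u i + #|[set ij : I * I | D ij.1 ij.2 != 0%VS]| <=
    \sum_(ij : I * I) \dim (D ij.1 ij.2) +
    (#|[set i | [exists j, D i j != 0%VS]]| + #|[set j | [exists i, D i j != 0%VS]]|))%N.
  apply: core => [j p p0|i q q0].
    have [i [q q0 qD]] := act_space_left al_lin al0 al_surj be_lin be_inj be_im p0.
    by exists i, q; rewrite // DE.
  have [j [p p0 pD]] := act_space_right al_lin al0 al_surj be_lin be_inj be_im q0.
  by exists j, p; rewrite // DE.
have setE : [set ij : I * I | D ij.1 ij.2 != 0%VS] = [set ij | nz ij.1 ij.2].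
  by apply/setP => ij; rewrite !inE nzE.
have setl : [set i | [exists j, D i j != 0%VS]] = [set i | [exists j, nz i j]].
  by apply/setP => i; rewrite !inE; apply: eq_existsb => j; rewrite nzE.
have setr : [set j | [exists i, D i j != 0%VS]] = [set j | [exists i, nz i j]].
  by apply/setP => j; rewrite !inE; apply: eq_existsb => i; rewrite nzE.
rewrite setE setl setr in core.
apply: leq_trans (leq_trans core _); last by rewrite leq_add2r.
by rewrite leq_add2r leq_add.
Qed.

End MinimalFaithful.

End Corners.

(** * Matrix units and central idempotents in a product of matrix rings *)

Lemma delta_mulmx_delta (k : fieldType) n (X : 'M[k]_n) (i i' j' j : 'I_n) :
  delta_mx i i' *m X *m delta_mx j' j = X i' j' *: delta_mx i j.
Proof.
have split0 a b : delta_mx a b = delta_mx a (0 : 'I_1) *m delta_mx 0 b :> 'M[k]_n.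
  by rewrite mul_delta_mx.
rewrite [delta_mx i i']split0 [delta_mx j' j]split0 [delta_mx i j]split0.
rewrite !mulmxA -(mulmxA _ _ X) -rowE -(mulmxA _ _ (delta_mx j' 0)) -colE.
rewrite [col j' _]mx11_scalar mul_mx_scalar -scalemxAl.
by rewrite !mxE.
Qed.

(** Commuting with the matrix units makes [X] scalar, and an idempotent scalar in a field is 0 or
    1. *)
Lemma central_idempotent_matrix (k : fieldType) n (X : 'M[k]_n.+1) :
  X * X = X -> (forall a b, X *m delta_mx a b = delta_mx a b *m X) ->
  X = 0 \/ X = 1.
Proof.
move=> XX XC.
have entry c a b : X c a = (c == a)%:R * X b b.
  have /matrixP/(_ c b) := XC a b; rewrite !mxE (bigD1 a) //= big1 ?addr0.
    rewrite mxE !eqxx mulr1 => ->; rewrite (bigD1 b) //= big1 ?addr0.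
      by rewrite mxE eqxx andbT.
    by move=> d db; rewrite mxE (negPf db) andbF mul0r.
  by move=> d da; rewrite mxE (negPf da) mulr0.
have XE : X = (X 0 0)%:M.
  by apply/matrixP => c a; rewrite (entry c a 0) !mxE mulr_natl.
have /eqP : X 0 0 * (X 0 0 - 1) = 0.
  have := congr1 (fun Y : 'M_n.+1 => Y 0 0) XX; rewrite {1}XE /= -[_ * _]/(_ *m _).
  by rewrite mul_scalar_mx mxE mulrBr mulr1 => ->; rewrite subrr.
rewrite mulf_eq0 subr_eq0 => /orP[]/eqP x0; rewrite XE x0; [left|by right].
by apply/matrixP => i j; rewrite !mxE mul0rn.
Qed.

Lemma card_image_finset (T : finType) (U : Type) (g : T -> U) (A : {set T})
    (B : set U) : injective g ->
  (forall y, B y <-> exists2 x, x \in A & y = g x) -> (B #= `I_#|A|)%card.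
Proof.
move=> ginj BE; pose h (i : 'I_#|A|) := g (enum_val i).
have hinj : set_inj [set: 'I_#|A|]%classic h by move=> i j _ _ /ginj/enum_val_inj.
have -> : B = (h @` [set: 'I_#|A|])%classic.
  apply/seteqP; split=> y.
    by move=> /BE[x xA ->]; exists (enum_rank_in xA x); rewrite // /h enum_rankK_in.
  by move=> [i _ <-]; apply/BE; exists (enum_val i); rewrite ?enum_valP.
have /Pinj[h' hE] := hinj; rewrite hE.
by rewrite (card_eql (card_image h')) (card_eqr card_II).
Qed.

Section MatrixUnits.
Variables (k : fieldType) (R : nzRingType) (iota : {rmorphism k -> R}).
Variables (n : nat) (m : 'I_n -> nat)
  (psi : forall i : 'I_n, {rmorphism jacquot R -> 'M[k]_((m i).+1)}).
Hypothesis psi_iota : forall i c, psi i (jacquot_pi (iota c)) = c%:M.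
Hypothesis psi_bij : bijective (fun x (i : 'I_n) => psi i x).

Local Notation J := (@jacobson R).
Local Notation pi := (@jacquot_pi R).

Lemma psi_inj x y : (forall i, psi i x = psi i y) -> x = y.
Proof.
by move=> xy; apply: (bij_inj psi_bij); apply: functional_extensionality_dep.
Qed.

Lemma psi_surj (A : forall i, 'M[k]_((m i).+1)) : exists x, forall i, psi i x = A i.
Proof.
by have [g _ gK] := psi_bij; exists (g A) => i; rewrite -[in RHS](gK A).
Qed.

Lemma psi_jacobson x : (forall i, psi i (pi x) = 0) -> x \in J.
Proof.
move=> x0; rewrite -[x]subr0; apply/jacquot_piP; apply: psi_inj => i.
by rewrite x0 !raddf0.
Qed.

Lemma psi_congr x y : (forall i, psi i (pi x) = psi i (pi y)) -> x - y \in J.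
Proof. by move=> xy; apply/jacquot_piP/psi_inj. Qed.

Lemma matrix_units : exists E : forall i, 'I_(m i).+1 -> 'I_(m i).+1 -> R,
  (forall i a b, psi i (pi (E i a b)) = delta_mx a b) /\
  (forall i j a b, j != i -> psi j (pi (E i a b)) = 0).
Proof.
have ex i (a b : 'I_(m i).+1) : exists x : R,
    psi i (pi x) = delta_mx a b /\ forall j, j != i -> psi j (pi x) = 0.
  (* Positions are compared as natural numbers because the blocks i and j have different index
     types. *)
  have [x xP] := psi_surj (fun j => \matrix_(c, d)
    ([&& j == i, c == a :> nat & d == b :> nat])%:R).
  exists (jacquot_repr x); rewrite jacquot_reprK; split=> [|j ji].
    by rewrite xP; apply/matrixP => c d; rewrite !mxE eqxx.
  by rewrite xP; apply/matrixP => c d; rewrite !mxE (negPf ji).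
have /fin_all_exists[E EP] i : exists f : 'I_(m i).+1 -> 'I_(m i).+1 -> R, forall a b,
    psi i (pi (f a b)) = delta_mx a b /\ forall j, j != i -> psi j (pi (f a b)) = 0.
  have /fin_all_exists[f fP] a := fin_all_exists (ex i a).
  by exists f.
exists E; split=> [i a b|i j a b]; first exact: (EP i a b).1.
exact: (EP i a b).2.
Qed.

Lemma phiM i x y : psi i (pi (x * y)) = psi i (pi x) *m psi i (pi y).
Proof. by rewrite !rmorphM. Qed.

Variable E : forall i, 'I_(m i).+1 -> 'I_(m i).+1 -> R.
Hypothesis E_diag : forall i a b, psi i (pi (@E i a b)) = delta_mx a b.
Hypothesis E_off : forall i j a b, j != i -> psi j (pi (@E i a b)) = 0.

Definition corner i := @E i 0 0.

(** Modulo J the product of [E i a 0], [E i 0 0] and [E i 0 a] is the diagonal unit [E i a a], so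
    these triples expand 1. *)
Definition corner_frame : seq (R * 'I_n * R) :=
  [seq (@E i a 0, i, @E i 0 a) | i <- enum 'I_n, a <- enum 'I_(m i).+1].

Lemma corner_one :
  1 - \sum_(l <- corner_frame) l.1.1 * corner l.1.2 * l.2 \in J.
Proof.
apply: psi_congr => l; rewrite big_allpairs_dep !rmorph1 !rmorph_sum /=.
rewrite big_enum /= (bigD1 l) //= [X in _ + X]big1 ?addr0 => [|i il]; last first.
  rewrite !rmorph_sum big1 // => a _.
  by rewrite !phiM E_off ?mul0mx // eq_sym.
rewrite !rmorph_sum big_enum /= -[LHS]/(1%:M) mx1_sum_delta.
by apply: eq_bigr => a _; rewrite !phiM !E_diag !mul_delta_mx.
Qed.

Lemma corner_diag i r : exists c, corner i * r * corner i - iota c * corner i \in J.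
Proof.
exists (psi i (pi r) 0 0); apply: psi_congr => l; rewrite !phiM psi_iota.
have [->|li] := eqVneq l i; last by rewrite E_off // !mul0mx mulmx0.
by rewrite E_diag delta_mulmx_delta mul_scalar_mx.
Qed.

Lemma corner_off i j r : i != j -> corner i * r * corner j \in J.
Proof.
move=> ij; apply: psi_jacobson => l; rewrite !phiM.
have [->|li] := eqVneq l i; last by rewrite E_off // !mul0mx.
by rewrite [X in _ *m X]E_off // mulmx0.
Qed.

Lemma corner_idem i : corner i * corner i - corner i \in J.
Proof.
apply: psi_congr => l; rewrite phiM.
have [->|li] := eqVneq l i; last by rewrite E_off // !mul0mx.
by rewrite E_diag mul_delta_mx.
Qed.

Lemma block_idempotents : exists f : 'I_n -> jacquot R,
  forall i l, psi l (f i) = (l == i)%:R.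
Proof. exact: (fin_all_exists (fun i => psi_surj (fun l => (l == i)%:R))). Qed.

Variable f : 'I_n -> jacquot R.
Hypothesis fE : forall i l, psi l (f i) = (l == i)%:R.

Lemma block_idempotent_inj : injective f.
Proof.
move=> i j /(congr1 (psi i)); rewrite !fE eqxx; case: eqP => // _ /eqP.
by rewrite oner_eq0.
Qed.

(** A central idempotent is 0 or 1 in each block, so it amounts to a set of blocks; the minimal
    nonzero ones are single blocks. *)
Lemma minimal_central_idempotentP g :
  minimal_central_idempotent g <-> exists i, g = f i.
Proof.
have central i : central_idempotent (f i).
  split=> [|x]; apply: psi_inj => l; rewrite !rmorphM !fE; case: eqP => _;
    by rewrite ?mul1r ?mulr1 ?mul0r ?mulr0.
have values h : central_idempotent h -> forall l, psi l h = 0 \/ psi l h = 1.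
  move=> [hh hC] l; apply: central_idempotent_matrix => [|a b].
    by rewrite -rmorphM hh.
  by rewrite -(@E_diag l) -[LHS]/(_ * _) -[RHS]/(_ * _) -!rmorphM hC.
split=> [[gc g0 gmin]|[i ->]].
  have [i gi] : exists i, psi i g = 1.
    apply: contrapT => ng; case/eqP: g0; apply: psi_inj => i; rewrite raddf0.
    by have [//|gi] := values g gc i; case: ng; exists i.
  exists i; apply/esym/gmin; first exact: central.
    by apply/eqP => /(congr1 (psi i)); rewrite fE eqxx raddf0 => /eqP; rewrite oner_eq0.
  split; apply: psi_inj => l; rewrite rmorphM fE; case: eqP => [->|_];
    by rewrite ?gi ?mul1r ?mul0r ?mulr0.
split; first exact: central.
  by apply/eqP => /(congr1 (psi i)); rewrite fE eqxx raddf0 => /eqP; rewrite oner_eq0.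
move=> h hc h0 [hf _].
have hl l : l != i -> psi l h = 0.
  by move=> li; rewrite hf rmorphM fE (negPf li) mulr0.
apply: psi_inj => l; rewrite fE; have [->|li] := eqVneq l i; last exact: hl.
have [hi|//] := values h hc i; case/eqP: h0; apply: psi_inj => l'; rewrite raddf0.
by have [->|/hl] := eqVneq l' i.
Qed.

Lemma block_cornerl i : jacquot_repr (f i) * corner i - corner i \in J.
Proof.
apply: psi_congr => l; rewrite phiM jacquot_reprK fE.
have [->|li] := eqVneq l i; first by rewrite mul1mx.
by rewrite E_off // mul0mx.
Qed.

Lemma block_cornerr i : corner i * jacquot_repr (f i) - corner i \in J.
Proof.
apply: psi_congr => l; rewrite phiM jacquot_reprK fE.
have [->|li] := eqVneq l i; first by rewrite mulmx1.
by rewrite E_off // mulmx0.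
Qed.

Lemma block_offl i j r : i != j -> corner i * r * jacquot_repr (f j) \in J.
Proof.
move=> ij; apply: psi_jacobson => l; rewrite !phiM jacquot_reprK fE.
have [->|li] := eqVneq l i; last by rewrite E_off // !mul0mx.
by rewrite (negPf ij) mulmx0.
Qed.

Lemma block_offr i j r : i != j -> jacquot_repr (f i) * r * corner j \in J.
Proof.
move=> ij; apply: psi_jacobson => l; rewrite !phiM jacquot_reprK fE.
have [->|li] := eqVneq l i; last by rewrite !mul0mx.
by rewrite E_off // mulmx0.
Qed.

End MatrixUnits.

(** * The socle graph expressed through corners, and its Euler characteristic *)

Section GraphOfCorners.
Variables (k : fieldType) (R : nzRingType) (iota : {rmorphism k -> R}).
Hypothesis R_findim : finite_dim_left iota.
Variables (I : finType) (e : I -> R) (f : I -> jacquot R).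
Local Notation J := (@jacobson R).
Local Notation S := (@ring_socle R).
Local Notation rep := (@jacquot_repr R).
Hypothesis block_idempotent_inj : injective f.
Hypothesis fP : forall g, minimal_central_idempotent g <-> exists i, g = f i.
Hypothesis fe : forall i, rep (f i) * e i - e i \in J.
Hypothesis ef : forall i, e i * rep (f i) - e i \in J.
Hypothesis ef_off : forall i j r, i != j -> e i * r * rep (f j) \in J.
Hypothesis fe_off : forall i j r, i != j -> rep (f i) * r * e j \in J.
Hypothesis corner_ex : forall s, s \in S -> s != 0 ->
  exists i r j r', e i * (r * s * r') * e j != 0.

Let nz i j := `[< exists2 s, s \in S & e i * s * e j != 0 >].

(** A nonzero element of f_i S f_j has some nonzero corner. An idempotent from another block would
    put a factor in J beside a socle element, so that corner sits at (i, j). Conversely f_i and f_j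
    fix the corner elements. *)
Lemma edge_corner i j :
  (exists2 x, x \in S & socle_ract (socle_lact (f i) x) (f j) != 0) <-> nz i j.
Proof.
split=> [[x xS]|/asboolP[s sS g0]]; last first.
  exists (e i * s * e j); first exact: (socleM _ (socleM _ sS).1).2.
  rewrite /socle_ract /socle_lact !mulrA (socle_congl R_findim (fe i) sS).
  by rewrite -mulrA (socle_congr R_findim (ef j)) // (socleM _ sS).1.
rewrite /socle_ract /socle_lact => y0.
set y := _ * _ in y0; have yS : y \in S by apply: (socleM _ (socleM _ xS).1).2.
have [i' [r [j' [r' g0]]]] := corner_ex yS y0.
have ii : i' = i.
  apply: contrapT => /eqP ii; case/eqP: g0.
  have -> : e i' * (r * y * r') * e j' =
      (e i' * r * rep (f i)) * (x * (rep (f j) * r' * e j')) by rewrite /y !mulrA.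
  by rewrite (jacobson_mul_socle R_findim (ef_off _ ii)) // (socleM _ xS).2.
have jj : j' = j.
  apply: contrapT => /eqP; rewrite eq_sym => jj; case/eqP: g0.
  have -> : e i' * (r * y * r') * e j' =
      (e i' * r * rep (f i) * x) * (rep (f j) * r' * e j') by rewrite /y !mulrA.
  by rewrite (socle_mul_jacobson R_findim (fe_off _ jj)) // (socleM _ xS).1.
rewrite {}ii {}jj in g0; apply/asboolP; exists (r * y * r') => //.
exact: (socleM _ (socleM _ yS).1).2.
Qed.

Lemma left_corner i :
  (exists2 x, x \in S & socle_lact (f i) x != 0) <-> [exists j, nz i j].
Proof.
split=> [[x xS]|/existsP[j /asboolP[s sS g0]]]; last first.
  exists (e i * s * e j); first exact: (socleM _ (socleM _ sS).1).2.
  by rewrite /socle_lact !mulrA (socle_congl R_findim (fe i) sS).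
rewrite /socle_lact => y0.
set y := _ * _ in y0; have yS : y \in S by apply: (socleM _ xS).1.
have [i' [r [j' [r' g0]]]] := corner_ex yS y0.
have ii : i' = i.
  apply: contrapT => /eqP ii; case/eqP: g0.
  have -> : e i' * (r * y * r') * e j' =
      (e i' * r * rep (f i)) * (x * (r' * e j')) by rewrite /y !mulrA.
  by rewrite (jacobson_mul_socle R_findim (ef_off _ ii)) // (socleM _ xS).2.
rewrite {}ii in g0; apply/existsP; exists j'; apply/asboolP.
exists (r * y * r') => //; exact: (socleM _ (socleM _ yS).1).2.
Qed.

Lemma right_corner j :
  (exists2 x, x \in S & socle_ract x (f j) != 0) <-> [exists i, nz i j].
Proof.
split=> [[x xS]|/existsP[i /asboolP[s sS g0]]]; last first.
  exists (e i * s * e j); first exact: (socleM _ (socleM _ sS).1).2.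
  rewrite /socle_ract -[_ * _ * rep _]mulrA (socle_congr R_findim (ef j)) //.
  exact: (socleM _ sS).1.
rewrite /socle_ract => y0.
set y := _ * _ in y0; have yS : y \in S by apply: (socleM _ xS).2.
have [i' [r [j' [r' g0]]]] := corner_ex yS y0.
have jj : j' = j.
  apply: contrapT => /eqP; rewrite eq_sym => jj; case/eqP: g0.
  have -> : e i' * (r * y * r') * e j' =
      (e i' * r * x) * (rep (f j) * r' * e j') by rewrite /y !mulrA.
  by rewrite (socle_mul_jacobson R_findim (fe_off _ jj)) // (socleM _ xS).1.
rewrite {}jj in g0; apply/existsP; exists i'; apply/asboolP.
exists (r * y * r') => //; exact: (socleM _ (socleM _ yS).1).2.
Qed.

Lemma corner_euler_characteristic : euler_characteristic (socle_graph R)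
  ((#|[set i | [exists j, nz i j]]| + #|[set j | [exists i, nz i j]]|)%N%:Z -
   #|[set ij : I * I | nz ij.1 ij.2]|%:Z).
Proof.
pose VL := [set i | [exists j, nz i j]]; pose VR := [set j | [exists i, nz i j]].
pose V := (inl @: VL) :|: (inr @: VR) : {set I + I}.
have cV : #|V| = (#|VL| + #|VR|)%N.
  rewrite cardsU (card_imset _ inl_inj) (card_imset _ inr_inj).
  suff -> : inl @: VL :&: inr @: VR = finset.set0 by rewrite cards0 subn0.
  apply/setP => z; rewrite !inE; apply/negP => /andP[/imsetP[i _ ->]].
  by move=> /imsetP[j].
exists (#|VL| + #|VR|)%N, #|[set ij : I * I | nz ij.1 ij.2]|; split=> //.
  rewrite -cV.
  pose g (z : I + I) := match z with inl i => inl (f i) | inr j => inr (f j) end : jacquot R + jacquot R.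
  apply: (@card_image_finset _ _ g) => [[i|i] [j|j] //= [/block_idempotent_inj ->] //|y].
  split=> [[[h [/fP[i ->] /left_corner hi] <-]|[h [/fP[i ->] /right_corner hi] <-]]|].
  - by exists (inl i) => //; rewrite inE imset_f // inE.
  - by exists (inr i) => //; rewrite inE [inr i \in inr @: _]imset_f ?orbT // inE.
  move=> [z]; rewrite inE => /orP[]/imsetP[i]; rewrite inE => hi -> ->; [left|right].
    by exists (f i) => //; split; [apply/fP; exists i | apply/left_corner].
  by exists (f i) => //; split; [apply/fP; exists i | apply/right_corner].
pose g (ij : I * I) := (inl (f ij.1), inr (f ij.2)) :
  (jacquot R + jacquot R) * (jacquot R + jacquot R).
apply: (@card_image_finset _ _ g) => [[i j] [i' j'] [/block_idempotent_inj -> /block_idempotent_inj ->] //|y].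
split=> [[h [h' [/fP[i ->] /fP[j ->] /edge_corner hij ->]]]|[[i j]]].
  by exists (i, j) => //; rewrite inE.
rewrite inE /= => hij ->; exists (f i), (f j); split=> //.
- by apply/fP; exists i.
- by apply/fP; exists j.
exact/edge_corner.
Qed.

End GraphOfCorners.

(** * Consequences of minimality among faithful modules *)

Section MinimalFaithfulModule.
Variables (k : fieldType) (R : nzRingType) (iota : {rmorphism k -> R}).
Hypothesis R_findim : finite_dim_left iota.
Variable M : lmodType R.
Hypothesis M_faithful : faithful M.
Local Notation S := (@ring_socle R).

(** The annihilator of a proper submodule is a nonzero two-sided ideal, hence meets the socle. *)
Lemma minimal_faithful_sub :
  (forall U : submodClosed M, (exists x : M, x \notin U) -> ~ faithful (submod U)) ->
  forall P : {pred M}, submod_closed P -> (exists x, x \notin P) ->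
  exists s, [/\ s \in S, s != 0 & forall x, x \in P -> s *: x = 0].
Proof.
move=> Mmin P Pc Px; have nf := Mmin (as_submod Pc) Px.
have [r rP r0] : exists2 r : R, (forall x, x \in P -> r *: x = 0) & r != 0.
  apply: contrapT => nr; apply: nf => r rP; apply/eqP; apply: contrapT => /negP r0.
  apply: nr; exists r => // x xP.
  by have /(congr1 val) := rP (Submod (xP : x \in as_submod Pc)).
have [|s [/asboolP sP sS s0]] := ideal_meets_socle R_findim (annihilator_ideal Pc).
  by exists r => //; apply/asboolP.
by exists s.
Qed.

Lemma minimal_faithful_quot :
  (forall N : submodClosed M, (exists2 x : M, x \in N & x != 0) -> ~ faithful (quotmod N)) ->
  forall P : {pred M}, submod_closed P -> (exists2 x, x \in P & x != 0) ->
  exists s, [/\ s \in S, s != 0 & forall x, s *: x \in P].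
Proof.
move=> Mmin P Pc Px; have nf := Mmin (as_submod Pc) Px.
have [r rP r0] : exists2 r : R, (forall x : M, r *: x \in P) & r != 0.
  apply: contrapT => nr; apply: nf => r rP; apply/eqP; apply: contrapT => /negP r0.
  apply: nr; exists r => // x.
  pose pi : M -> quotmod (as_submod Pc) := @quotmod_pi R M (as_submod Pc).
  have piZ y : pi (r *: y) = r *: pi y by apply: quotmod_piZ.
  have piD y z : pi (y + z) = pi y + pi z by apply: quotmod_piD.
  have pi0 : pi 0 = 0 by apply: (addrI (pi 0)); rewrite -piD !addr0.
  have : pi (r *: x) = pi 0 by rewrite piZ pi0.
  by move/quotmod_piP; rewrite subr0.
have [|s [/asboolP sP sS s0]] := ideal_meets_socle R_findim (transporter_ideal Pc).
  by exists r => //; apply/asboolP.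
by exists s.
Qed.

(** No finiteness is assumed of M. Take a finite family generating a submodule whose annihilator has
    least dimension. Adding any further element leaves that annihilator unchanged, so it kills M and
    is zero; by minimality the family generates M. *)
Lemma minimal_faithful_kspanned :
  (forall P : {pred M}, submod_closed P -> (exists x, x \notin P) ->
    exists s, [/\ s \in S, s != 0 & forall x, x \in P -> s *: x = 0]) ->
  kspanned iota M.
Proof.
move=> Mmin; have [nn [d dP]] := kdimension (regular_kspanned R_findim).
pose P n (x : 'I_n -> M) : {pred M} := fun y => `[< exists r : 'I_n -> R, y = \sum_i r i *: x i >].
have Pc n x : submod_closed (@P n x).
  split=> [|a y z /asboolP[r ->] /asboolP[r' ->]]; apply/asboolP.
    by exists (fun=> 0); rewrite big1 // => i _; rewrite scale0r.
  exists (fun i => a * r i + r' i); rewrite scaler_sumr -big_split.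
  by apply: eq_bigr => i _ /=; rewrite scalerDl scalerA.
pose ann n x : {pred R} := fun r => `[< forall y, y \in @P n x -> r *: y = 0 >].
have annc n x : kclosed iota (@ann n x : {pred R^o}).
  exact/submod_kclosed/ideal_submod/annihilator_ideal.
pose Q c := `[< exists n x, d (@ann n x) = c >].
have exQ : exists c, Q c.
  by exists (d (@ann 0 (fun=> 0))); apply/asboolP; exists 0%N, (fun=> 0).
case: (ex_minnP exQ) => _ /asboolP[n [x <-]] minx.
have ann0 r : r \in @ann n x -> r = 0.
  move=> rx; apply: M_faithful => y.
  pose x' (i : 'I_n.+1) := if unlift ord0 i is Some j then x j else y.
  have sub : {subset @ann n.+1 x' <= @ann n x}.
    move=> r' /asboolP rP'; apply/asboolP => z /asboolP[c ->]; apply: rP'.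
    apply/asboolP; exists (fun i => if unlift ord0 i is Some j then c j else 0).
    rewrite big_ord_recl unlift_none scale0r add0r; apply: eq_bigr => i _.
    by rewrite /x' liftK.
  have [_ _ h] := dP _ _ (annc n.+1 x') (annc n x) sub.
  have /h/(_ r rx)/asboolP : (d (@ann n x) <= d (@ann n.+1 x'))%N.
    by apply: minx; apply/asboolP; exists n.+1, x'.
  apply; apply/asboolP; exists (fun i => (i == ord0)%:R).
  rewrite big_ord_recl eqxx scale1r /x' unlift_none big1 ?addr0 // => i _.
  by rewrite scale0r.
have Pall y : y \in @P n x.
  apply: contrapT => /negP yP.
  have [|s [_ s0 sP]] := Mmin _ (Pc n x); first by exists y.
  by case/eqP: s0; apply: ann0; apply/asboolP.
have [N [b bP]] := R_findim.
exists #|{: 'I_n * 'I_N}|, (fun z => b (enum_val z).2 *: x (enum_val z).1) => y.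
have /asboolP[r ->] := Pall y.
have /choice[c cP] i : exists c : 'I_N -> k, r i = \sum_l iota (c l) * b l by apply: bP.
exists (fun z => c (enum_val z).1 (enum_val z).2).
transitivity (\sum_(z : 'I_n * 'I_N) (iota (c z.1 z.2) * b z.2) *: x z.1).
  rewrite -(pair_big xpredT xpredT (fun i l => (iota (c i l) * b l) *: x i)) /=.
  by apply: eq_bigr => i _; rewrite cP scaler_suml.
rewrite (reindex (@enum_val _ {: 'I_n * 'I_N})) /=; last exact/onW_bij/enum_val_bij.
by apply: eq_bigr => z _; rewrite scalerA.
Qed.

End MinimalFaithfulModule.

Lemma infinite_fresh (k : fieldType) : infinite_set [set: k]%classic ->
  forall s : seq k, exists t, t \notin s.
Proof.
move=> kinf s; apply: contrapT => ns; apply: kinf.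
apply: (@sub_finite_set _ _ [set` s]%classic); last exact: finite_seq.
by move=> t _ /=; apply: contrapT => /negP ts; apply: ns; exists t.
Qed.

Lemma faithful_length_bound (k : fieldType) (R : nzRingType)
    (iota : {rmorphism k -> R}) (M : lmodType R) :
  infinite_set [set: k]%classic -> finite_dim_left iota ->
  (forall (c : k) (x : jacquot R),
     jacquot_pi (iota c) * x = x * jacquot_pi (iota c)) ->
  (forall (c : k) (x : R), x \in @ring_socle R -> iota c * x = x * iota c) ->
  product_of_matrix_rings (fun c : k => jacquot_pi (iota c)) ->
  faithful M ->
  (forall U : submodClosed M,
     (exists x : M, x \notin U) -> ~ faithful (submod U)) ->
  (forall N : submodClosed M,
     (exists2 x : M, x \in N & x != 0) -> ~ faithful (quotmod N)) ->
  exists (a b c : nat) (chi : int),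
    [/\ module_length (quotmod (@jacobson_smul R M)) a,
        module_length (submod (@socle R M)) b,
        bimodule_length (@ring_socle R) c,
        euler_characteristic (socle_graph R) chi &
        a%:Z + b%:Z <= c%:Z + chi].
Proof.
move=> kinf R_findim kcentral ksocle [n [m [psi [psi_iota psi_bij]]]] Mf Msub Mquot.
have comm c r : iota c * r - r * iota c \in @jacobson R.
  by apply/jacquot_piP; rewrite !rmorphM /= kcentral.
have [E [E_diag E_off]] := matrix_units psi_bij.
have [f fE] := block_idempotents psi_bij.
have one := corner_one psi_bij E_diag E_off.
have diag := corner_diag psi_iota psi_bij E_diag E_off.
have off := corner_off psi_bij E_off.
have idem := corner_idem psi_bij E_diag E_off.
have sub := minimal_faithful_sub R_findim Msub.
have quo := minimal_faithful_quot R_findim Mquot.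
have Mk := minimal_faithful_kspanned R_findim Mf sub.
have [a [b [c [aL bL cL ineq]]]] := corner_inequality R_findim comm ksocle one
  diag off idem Mf sub quo (infinite_fresh kinf) Mk.
exists a, b, c; eexists; split=> //.
  apply: (corner_euler_characteristic R_findim (block_idempotent_inj fE)
    (minimal_central_idempotentP psi_bij E_diag fE)
    (block_cornerl psi_bij E_off fE) (block_cornerr psi_bij E_off fE)
    (block_offl psi_bij E_off fE) (block_offr psi_bij E_off fE)).
  exact: (socle_corner R_findim one).
rewrite addrA Num.Theory.lerBrDr -!PoszD; exact: ineq.
Qed.

(** * Burnside's theorem over an algebraically closed field *)

Lemma closed_field_eigenvalue (k : fieldType) n (Y : 'M[k]_n) :
  GRing.closed_field_axiom k -> (0 < n)%N ->
  exists c : k, (\rank (Y - c%:M)%R < n)%N.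
Proof.
move=> kcl n0; have /(PreClosedField.closed_rootP kcl)[c cr] : size (char_poly Y) != 1%N.
  by rewrite size_char_poly eqSS -lt0n.
exists c; rewrite ltn_neqAle rank_leq_row andbT.
move: cr; rewrite -eigenvalue_root_char /eigenvalue /eigenspace.
by apply: contra => yf; rewrite -[_ == _]negbK kermx_eq0 /row_free yf.
Qed.

Section Burnside.
Variables (k : fieldType) (n : nat) (A : {pred 'M[k]_n.+1}).
Hypothesis k_closed : GRing.closed_field_axiom k.
Hypothesis A_lin : submod_closed A.
Hypothesis A_mul : forall X Y, X \in A -> Y \in A -> X *m Y \in A.
Hypothesis A_one : 1%:M \in A.
Hypothesis A_trans : forall v w : 'cV[k]_n.+1, v != 0 ->
  exists2 X, X \in A & X *m v = w.

Lemma subalgebra_sub X Y : X \in A -> Y \in A -> X - Y \in A.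
Proof. by move=> XA YA; rewrite addrC -scaleN1r A_lin.2. Qed.

Lemma subalgebra_scale c X : X \in A -> c *: X \in A.
Proof. by move=> XA; rewrite -[_ *: _]addr0 A_lin.2 // A_lin.1. Qed.

(* If T has minimal nonzero rank r > 1, write T = B C with inner dimension r and
   pick an eigenvalue c of C X B: then T X T - c T has smaller rank, and it is
   nonzero for a suitable X. *)
Lemma burnside_rank_one : exists (x : 'cV[k]_n.+1) (y : 'rV[k]_n.+1),
  [/\ x *m y \in A, x != 0 & y != 0].
Proof.
pose Q r := `[< exists T, [/\ T \in A, T != 0 & \rank T = r] >].
have exQ : exists r, Q r.
  exists (\rank (1%:M : 'M[k]_n.+1)); apply/asboolP; exists 1%:M; split=> //.
  exact: oner_neq0.
case: (ex_minnP exQ) => _ /asboolP[T [TA T0 <-]] minT.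
have r0 : (0 < \rank T)%N by rewrite lt0n mxrank_eq0.
have [r2|r1] := ltnP 1 (\rank T).
  have [B [C [TE Bfull Cfree]]] : exists (B : 'M[k]_(n.+1, \rank T))
      (C : 'M[k]_(\rank T, n.+1)), [/\ T = B *m C, row_full B & row_free C].
    exists (col_base T), (row_base T).
    by rewrite mulmx_base col_base_full row_base_free.
  have Cs (p : 'cV[k]_(\rank T)) : exists z, C *m z = p.
    have /row_freeP[C' CC] := Cfree.
    by exists (C' *m p); rewrite mulmxA CC mul1mx.
  have Bi (p : 'cV[k]_(\rank T)) : B *m p = 0 -> p = 0.
    have /row_fullP[B' BB] := Bfull.
    by move/(congr1 (mulmx B')); rewrite mulmxA BB mul1mx mulmx0.
  (* With [X] sending [T *m z1] to [z2], the vectors T X T z1 and T z1 are the images under the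
     injective [B] of two different basis vectors, so T X T is not a multiple of [T]. *)
  have [z1 z1E] := Cs (delta_mx (Ordinal r0) 0).
  have [z2 z2E] := Cs (delta_mx (Ordinal r2) 0).
  have [|X XA XE] := @A_trans (T *m z1) z2.
    rewrite TE -mulmxA z1E; apply/eqP => /Bi/matrixP/(_ (Ordinal r0) 0).
    by rewrite !mxE !eqxx => /eqP; rewrite oner_eq0.
  have [c cP] := closed_field_eigenvalue (C *m X *m B) k_closed r0.
  pose T' := T *m X *m T - c *: T.
  have T'A : T' \in A by rewrite subalgebra_sub ?subalgebra_scale // !A_mul.
  have T'0 : T' != 0.
    apply/eqP => /(congr1 (mulmx^~ z1)); rewrite mul0mx mulmxBl -!mulmxA XE.
    rewrite -scalemxAl TE -!mulmxA z1E z2E scalemxAr -mulmxBr => /Bi.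
    move=> /matrixP/(_ (Ordinal r2) 0); rewrite !mxE !eqxx /=.
    by rewrite mulr0 subr0 => /eqP; rewrite oner_eq0.
  have : (\rank T' < \rank T)%N.
    apply: leq_ltn_trans cP.
    have -> : T' = B *m (C *m X *m B - c%:M) *m C.
      rewrite mulmxBr mulmxBl mul_mx_scalar -scalemxAl -TE /T'; congr (_ - _).
      by rewrite [in LHS]TE !mulmxA.
    by rewrite (leq_trans (mxrankM_maxl _ _)) // mxrankM_maxr.
  by rewrite ltnNge minT //; apply/asboolP; exists T'.
have r1' : \rank T = 1%N by apply/eqP; rewrite eqn_leq r1 r0.
have [x [y xy]] : exists (x : 'cV[k]_n.+1) (y : 'rV[k]_n.+1), T = x *m y.
  move: (mulmx_base T); move: (col_base T) (row_base T); rewrite r1' => x y e.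
  by exists x, y.
exists x, y; rewrite -xy; split=> //.
  by apply: contraNneq T0 => x0; rewrite xy x0 mul0mx.
by apply: contraNneq T0 => y0; rewrite xy y0 mulmx0.
Qed.

(** Starting from one rank one element x y of [A], transitivity replaces x by any column. The
    admissible rows form a space containing all y Y with Y in [A]; were it proper, a nonzero column
    z would satisfy y Y z = 0 for all Y, and as Y z takes every value, y would be 0. *)
Lemma burnside X : X \in A.
Proof.
have [x [y [xyA x0 y0]]] := burnside_rank_one.
pose P : {pred 'rV[k]_n.+1} := fun p => `[< forall v : 'cV[k]_n.+1, v *m p \in A >].
have Pc : submod_closed P.
  split=> [|c p q /asboolP pP /asboolP qP]; apply/asboolP => v.
    by rewrite mulmx0 A_lin.1.
  by rewrite mulmxDr -scalemxAr A_lin.2.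
have yP Y : Y \in A -> y *m Y \in P.
  move=> YA; apply/asboolP => v; have [Z ZA <-] := A_trans v x0.
  by rewrite -mulmxA (mulmxA x) A_mul // A_mul.
have [U UE] := closed_vspace Pc.
have Pall p : p \in P.
  rewrite -UE; apply: contrapT => /negP pU.
  have [phi [phi1 phiU]] := separating_form pU.
  pose z : 'cV[k]_n.+1 := \col_i phi (delta_mx 0 i).
  have phiE q : phi q = (q *m z) 0 0.
    rewrite {1}[q]row_sum_delta linear_sum mxE; apply: eq_bigr => i _.
    by rewrite linearZ /= mxE.
  have z0 : z != 0.
    by apply/eqP => z0; have := oner_neq0 k; rewrite -phi1 phiE z0 mulmx0 mxE eqxx.
  case/eqP: y0; apply/rowP => i.
  have [Y YA YE] := A_trans (delta_mx i 0) z0.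
  have : phi (y *m Y) = 0 by apply: phiU; rewrite UE yP.
  by rewrite phiE -mulmxA YE -colE !mxE.
have -> : X = \sum_i (delta_mx (0 : 'I_1) i)^T *m row i X.
  apply/row_matrixP => l; rewrite linear_sum (bigD1 l) //= big1 => [|i il].
    by rewrite addr0 row_outer mxE !eqxx scale1r.
  by rewrite row_outer mxE eq_sym (negPf il) andbF scale0r.
elim/big_ind: _ => [|Y Z YA ZA|i _]; first exact: A_lin.1.
  by have := A_lin.2 1 _ _ YA ZA; rewrite scale1r.
by have /asboolP := Pall (row i X); apply.
Qed.

End Burnside.

(** * R / J as a product of matrix rings over an algebraically closed field *)

Lemma matrix_of_quotient (k : fieldType) (R : nzRingType)
    (iota : {rmorphism k -> R}) (V : lmodType R) t u
    (f : V -> 'rV[k]_t) (h : V -> 'rV[k]_u) :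
  klinear iota f -> (forall p, exists x, f x = p) -> klinear iota h ->
  (forall x, f x = 0 -> h x = 0) ->
  exists X : 'M[k]_(t, u), forall x, h x = f x *m X.
Proof.
move=> fL fs hL fh.
have /fin_all_exists[x xP] (l : 'I_t) : exists x, f x = delta_mx 0 l by apply: fs.
exists (\matrix_l h (x l)) => y.
have e : f (y - \sum_l iota (f y 0 l) *: x l) = 0.
  apply/eqP; rewrite (klinearB fL) (klinear_sum fL) subr_eq0 {1}[f y]row_sum_delta.
  by apply/eqP/eq_bigr => l _; rewrite (klinearZ fL) xP.
have := fh _ e; rewrite (klinearB hL) (klinear_sum hL) => /eqP.
rewrite subr_eq0 => /eqP ->; rewrite mulmx_sum_row; apply: eq_bigr => l _.
by rewrite (klinearZ hL) rowK.
Qed.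

Section Wedderburn.
Variables (k : fieldType) (R : nzRingType) (iota : {rmorphism k -> R}).
Hypothesis R_findim : finite_dim_left iota.
Hypothesis iota_comm : forall c r, iota c * r - r * iota c \in @jacobson R.
Hypothesis k_closed : GRing.closed_field_axiom k.
Local Notation J := (@jacobson R).
Local Notation pi := (@jacquot_pi R).

(** This is the action of R on the simple module R / I. It is [k]-linear because J lies in I, and
    maximality of I gives the transitivity required by [burnside]. *)
Lemma simple_quotient_representation (I : submodClosed R^o) :
  maximal_left_ideal I ->
  exists n (psi : {rmorphism jacquot R -> 'M[k]_n.+1}),
    [/\ forall c, psi (pi (iota c)) = c%:M, forall X, exists r, psi (pi r) = X &
        forall r, psi (pi r) = 0 <-> forall x : R, (r * x : R^o) \in I].
Proof.
move=> mI; have Ic := submodClosed_closed I.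
have JI (j : R) : j \in J -> (j : R^o) \in I by move=> /asboolP; apply.
have [t [f [fL f0 fs]]] := quotient_coordinates (regular_kspanned R_findim)
  (submod_kclosed iota Ic).
have hL (r : R) : klinear iota (fun x : R^o => f (r *: x)).
  move=> c x y; rewrite scalerDr (klinearD fL); congr (_ + _).
  apply/eqP; rewrite -subr_eq0 -(klinearZ fL) -(klinearB fL); apply/eqP/f0.
  rewrite !scalerA -scalerBl; apply: JI.
  have jJ : r * iota c - iota c * r \in J by rewrite -opprB rpredN.
  exact: ((jacobson_closed R).2 (x : R) _ jJ).2.
have f_eq0 (r : R) x : f x = 0 -> f (r *: x) = 0.
  by move=> /f0 xI; apply/f0; rewrite -[_ *: _]addr0 Ic.2 // Ic.1.
have [rho rhoP] := choice (fun r => matrix_of_quotient fL fs (hL r) (f_eq0 r)).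
have rho_uniq r X : (forall x, f (r *: x) = f x *m X) -> rho r = X.
  move=> h; apply/row_matrixP => l; have [x xl] := fs (delta_mx 0 l).
  by rewrite !rowE -xl -rhoP h.
have rhoJ r r' : r - r' \in J -> rho r = rho r'.
  move=> rJ; apply: rho_uniq => x; rewrite -rhoP; apply/eqP.
  rewrite -subr_eq0 -(klinearB fL) -scalerBl; apply/eqP/f0/JI.
  exact: ((jacobson_closed R).2 (x : R) _ rJ).2.
case: t f fL f0 fs hL f_eq0 rho rhoP rho_uniq rhoJ => [|n] f fL f0 fs hL f_eq0 rho rhoP rho_uniq rhoJ.
  by case/negP: mI.1; apply/f0/matrixP => i [].
(* On row vectors [rho] reverses products; the transpose restores their order. *)
pose psi (x : jacquot R) : 'M[k]_n.+1 := (rho (jacquot_repr x))^T.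
have psiE r : psi (pi r) = (rho r)^T.
  rewrite /psi; congr (_^T); apply: rhoJ; apply/jacquot_piP.
  exact: jacquot_reprK.
have psiB : zmod_morphism psi.
  move=> x y; rewrite -(jacquot_reprK x) -(jacquot_reprK y) -rmorphB !psiE.
  rewrite -linearB /=; congr (_^T); apply: rho_uniq => z.
  by rewrite scalerBl (klinearB fL) mulmxBr -!rhoP.
have psiM : monoid_morphism psi.
  split=> [|x y].
    rewrite -(rmorph1 pi) psiE -[RHS]trmx1; congr (_^T); apply: rho_uniq => z.
    by rewrite scale1r mulmx1.
  rewrite -(jacquot_reprK x) -(jacquot_reprK y) -rmorphM !psiE.
  rewrite -[RHS]trmx_mul; congr (_^T); apply: rho_uniq => z.
  by rewrite -scalerA rhoP rhoP mulmxA.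
pose Psi : {rmorphism jacquot R -> 'M[k]_n.+1} := HB.pack psi
  (GRing.isZmodMorphism.Build _ _ psi psiB) (GRing.isMonoidMorphism.Build _ _ psi psiM).
have rho_iota c : rho (iota c) = c%:M.
  by apply: rho_uniq => x; rewrite (klinearZ fL) mul_mx_scalar.
exists n, Psi; split=> [c|X|r].
- by rewrite [LHS]psiE rho_iota tr_scalar_mx.
- pose A : {pred 'M[k]_n.+1} := fun Y => `[< exists r, psi (pi r) = Y >].
  suff /asboolP : X \in A by [].
  apply: burnside => // [|Y Z /asboolP[r <-] /asboolP[r' <-]||v w v0].
  + split=> [|c Y Z /asboolP[r <-] /asboolP[r' <-]]; apply/asboolP.
      by exists 0; rewrite [pi 0]raddf0; apply: (raddf0 Psi).
    exists (iota c * r + r'); rewrite rmorphD rmorphM.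
    rewrite [LHS](raddfD Psi) /= psiM.2 [psi (pi (iota c))]psiE rho_iota.
    by rewrite tr_scalar_mx -mul_scalar_mx.
  + by apply/asboolP; exists (r * r'); rewrite rmorphM psiM.2.
  + by apply/asboolP; exists 1; rewrite rmorph1 psiM.1.
  have [x xv] := fs v^T; have [y yw] := fs w^T.
  have xI : x \notin I.
    apply: contra v0 => /f0; rewrite xv => /(congr1 trmx).
    by rewrite trmxK trmx0 => ->.
  (* K is I + Rx; since x is outside I, maximality makes it all of R, so some r sends x to y modulo
     I. *)
  pose K : {pred R^o} := fun z => `[< exists r : R, z - r *: x \in I >].
  have Kc : submod_closed K.
    split; first by apply/asboolP; exists 0; rewrite scale0r subr0 Ic.1.
    move=> a y1 z /asboolP[r ry] /asboolP[r' rz]; apply/asboolP.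
    exists (a * r + r'); have -> : a *: y1 + z - (a * r + r') *: x =
        a *: (y1 - r *: x) + (z - r' *: x).
      by rewrite scalerBr scalerDl -scalerA opprD addrACA.
    exact: Ic.2.
  have [_ /(_ (as_submod Kc))] := mI; case.
  + by move=> z zI; apply/asboolP; exists 0; rewrite scale0r subr0.
  + move=> KI; case/negP: xI; apply: KI; apply/asboolP; exists 1.
    by rewrite scale1r subrr Ic.1.
  move=> /(_ y)/asboolP[r /f0]; rewrite (klinearB fL) => /eqP.
  rewrite subr_eq0 => /eqP yr; exists (psi (pi r)); first by apply/asboolP; exists r.
  by rewrite psiE; apply: trmx_inj; rewrite trmx_mul trmxK -xv -rhoP -yr.
split=> [r0 x|rI].
  apply/f0; rewrite -[(_ * _ : R^o)]/(r *: (x : R^o)) rhoP.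
  by rewrite -[rho r]trmxK -psiE [psi _]r0 trmx0 mulmx0.
rewrite [LHS]psiE -[RHS]trmx0; congr (_^T); apply: rho_uniq => x.
by rewrite mulmx0; apply/f0/rI.
Qed.

(** The annihilator of the module R / I. *)
Definition primitive (I : submodClosed R^o) : {pred R} :=
  fun r => `[< forall x : R^o, r *: x \in I >].

Lemma primitive_ideal I : ideal_closed (primitive I).
Proof. exact/transporter_ideal/submodClosed_closed. Qed.

Let covers s (Im : 'I_s -> submodClosed R^o) : Prop :=
  (forall i, maximal_left_ideal (Im i)) /\
  (forall r, (forall i, r \in primitive (Im i)) -> r \in J).

(** Among finite families of maximal left ideals, take one whose primitive ideals have an
    intersection of least dimension. Adding any maximal left ideal does not shrink it, so the
    intersection lies in J. *)
Lemma finite_cover : exists s (Im : 'I_s -> submodClosed R^o), covers Im.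
Proof.
have [nn [d dP]] := kdimension (regular_kspanned R_findim).
pose P s (Im : 'I_s -> submodClosed R^o) : {pred R^o} :=
  fun r => `[< forall i, r \in primitive (Im i) >].
have Pc s Im : kclosed iota (@P s Im).
  split=> [|c x y /asboolP xP /asboolP yP]; apply/asboolP => i.
    exact: (ideal_submod (primitive_ideal (Im i))).1.
  exact: (ideal_submod (primitive_ideal (Im i))).2.
pose Q c := `[< exists s Im, (forall i, maximal_left_ideal (Im i)) /\ d (@P s Im) = c >].
have exQ : exists c, Q c.
  pose Im0 (i : 'I_0) : submodClosed R^o := as_submod (ideal_submod (jacobson_closed R)).
  exists (d (@P 0%N Im0)); apply/asboolP; exists 0%N, Im0.
  by split=> // -[].
case: (ex_minnP exQ) => _ /asboolP[s [Im [mIm <-]]] minIm.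
exists s, Im; split=> // r rP; apply/asboolP => I mI.
pose Im' (i : 'I_s.+1) := if unlift ord0 i is Some j then Im j else I.
have sub : {subset @P s.+1 Im' <= @P s Im}.
  move=> x /asboolP xP; apply/asboolP => i.
  by have := xP (lift ord0 i); rewrite /Im' liftK.
have [_ _ h] := dP _ _ (Pc _ Im') (Pc _ Im) sub.
have /h/(_ r) : (d (@P s Im) <= d (@P s.+1 Im'))%N.
  apply: minIm; apply/asboolP; exists s.+1, Im'; split=> // i.
  by rewrite /Im'; case: unliftP.
have rPs : (r : R^o) \in @P s Im by apply/asboolP.
move=> /(_ rPs)/asboolP/(_ ord0); rewrite /Im' unlift_none => /asboolP/(_ 1).
by rewrite -[_ *: _]/(r * 1) mulr1.
Qed.

(** In a cover with as few members as possible, an inclusion of primitive ideals would allow the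
    member with the larger one to be dropped. *)
Lemma irredundant_cover : exists s (Im : 'I_s -> submodClosed R^o), covers Im /\
  forall i j, i != j -> exists2 r, r \in primitive (Im i) & r \notin primitive (Im j).
Proof.
pose Q s := `[< exists Im : 'I_s -> submodClosed R^o, covers Im >].
have exQ : exists s, Q s.
  by have [s [Im ImP]] := finite_cover; exists s; apply/asboolP; exists Im.
case: (ex_minnP exQ) => s /asboolP[Im [mIm ImJ]] mins; exists s, Im; split=> // i j ij.
apply: contrapT => nr.
have sub r : r \in primitive (Im i) -> r \in primitive (Im j).
  by move=> ri; apply: contrapT => /negP rj; apply: nr; exists r.
case: s => [|s] in Im mIm ImJ mins i j ij nr sub *; first by case: (i).
have := mins s; rewrite ltnn => /(_ _)/negP; apply; rewrite ?negbK //.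
apply/asboolP; exists (Im \o lift j); split=> [l|r rP]; first exact: mIm.
apply: ImJ => l; have [->|lj] := eqVneq l j; last first.
  by rewrite eq_sym in lj; case/unlift_some: lj => l' -> _; apply: (rP l').
apply: sub; have [l' il] : exists l', i = lift j l'.
  by rewrite eq_sym in ij; case/unlift_some: ij => l' -> _; exists l'.
by rewrite il; apply: (rP l').
Qed.

(** A Chinese remainder argument: elements that are 1 in one block and 0 in the others give
    surjectivity, and the covering property gives injectivity. *)
Lemma wedderburn : product_of_matrix_rings (fun c : k => pi (iota c)).
Proof.
have [s [Im [[mIm ImJ] Im_irr]]] := irredundant_cover.
have /fin_all_exists[m /fin_all_exists[psi psiP]] i :=
  simple_quotient_representation (mIm i).
have psi_iota i c : psi i (pi (iota c)) = c%:M by have [+ _ _] := psiP i; apply.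
have psi_surj i X : exists r, psi i (pi r) = X by have [_ + _] := psiP i; apply.
have psi_ker i r : psi i (pi r) = 0 <-> r \in primitive (Im i).
  have [_ _ ker] := psiP i; rewrite ker; split=> [h|/asboolP h]; first exact/asboolP.
  by move=> x; apply: h.
exists s, m, psi; split; first exact: psi_iota.
(* Block i is a simple ring: a nonzero entry of [r], moved to each diagonal place, makes the sum of
   the p_c r q_c equal to 1 there, while every term still vanishes in block j. *)
have split1 i j : i != j -> exists z, psi i (pi z) = 1 /\ psi j (pi z) = 0.
  move=> ij; have [|r rj ri] := Im_irr j i; first by rewrite eq_sym.
  have X0 : psi i (pi r) != 0 by apply: contra ri => /eqP/psi_ker.
  have [a [b Xab]] : exists a b, psi i (pi r) a b != 0.
    apply: contrapT => nX; case/eqP: X0; apply/matrixP => a b; rewrite mxE.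
    by apply/eqP; apply: contrapT => /negP h; apply: nX; exists a, b.
  have /fin_all_exists[p pE] (c : 'I_(m i).+1) :
      exists p, psi i (pi p) = (psi i (pi r) a b)^-1 *: delta_mx c a by apply: psi_surj.
  have /fin_all_exists[q qE] (c : 'I_(m i).+1) :
      exists q, psi i (pi q) = delta_mx b c by apply: psi_surj.
  exists (\sum_c p c * r * q c); split.
    rewrite !rmorph_sum -[RHS]/(1%:M) mx1_sum_delta; apply: eq_bigr => c _ /=.
    rewrite !rmorphM pE qE -[LHS]/(_ *m _ *m _) -!scalemxAl delta_mulmx_delta.
    by rewrite scalerA mulVf // scale1r.
  rewrite !rmorph_sum big1 // => c _ /=.
  by rewrite !rmorphM (_ : psi j (pi r) = 0) ?mulr0 ?mul0r //; apply/psi_ker.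
have splits i (js : seq 'I_s) : i \notin js ->
    exists z, psi i (pi z) = 1 /\ forall j, j \in js -> psi j (pi z) = 0.
  elim: js => [|j js IHjs]; first by exists 1; rewrite !rmorph1.
  rewrite inE negb_or => /andP[ij /IHjs[z [z1 z0]]].
  have [y [y1 y0]] := split1 i j ij; exists (y * z); split.
    by rewrite !rmorphM y1 z1 mulr1.
  move=> l; rewrite inE => /orP[/eqP->|/z0 zl]; first by rewrite !rmorphM y0 mul0r.
  by rewrite !rmorphM zl mulr0.
have /fin_all_exists[z zP] i : exists z, psi i (pi z) = 1 /\
    forall j, j != i -> psi j (pi z) = 0.
  have [|z [z1 z0]] := splits i [seq j <- enum 'I_s | j != i].
    by rewrite mem_filter eqxx.
  by exists z; split=> // j ji; apply: z0; rewrite mem_filter ji mem_enum.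
have surj (A : forall i, 'M[k]_((m i).+1)) : exists x, (fun i => psi i x) = A.
  have /fin_all_exists[r rE] i : exists r, psi i (pi r) = A i by apply: psi_surj.
  exists (pi (\sum_i z i * r i)); apply: functional_extensionality_dep => i.
  rewrite !rmorph_sum (bigD1 i) //= big1 => [|j ji].
    by rewrite addr0 !rmorphM rE (zP i).1 mul1r.
  by rewrite !rmorphM (zP j).2 ?mul0r // eq_sym.
have [g gK] := choice surj; exists g => [x|A]; last exact: gK.
have : forall i, psi i (g (fun i => psi i x) - x) = 0.
  by move=> i; rewrite raddfB; apply/eqP; rewrite subr_eq0; apply/eqP; apply: (congr1 (fun h => h i) (gK _)).
set y := g _; rewrite -(jacquot_reprK y) -(jacquot_reprK x) -rmorphB => yx.
apply/jacquot_piP/ImJ => i; apply/psi_ker; exact: yx.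
Qed.

End Wedderburn.

Theorem theorem11 (k : fieldType) (R : nzRingType)
    (iota : {rmorphism k -> R})
    (k_infinite : infinite_set [set: k]%classic)
    (R_findim : finite_dim_left iota)
    (k_central : forall (c : k) (x : jacquot R),
       jacquot_pi (iota c) * x = x * jacquot_pi (iota c))
    (k_socle : forall (c : k) (x : R),
       x \in @ring_socle R -> iota c * x = x * iota c) :
  (GRing.closed_field_axiom k ->
     product_of_matrix_rings (fun c : k => jacquot_pi (iota c))) /\
  (product_of_matrix_rings (fun c : k => jacquot_pi (iota c)) ->
   forall M : lmodType R,
     faithful M ->
     (forall U : submodClosed M,
        (exists x : M, x \notin U) -> ~ faithful (submod U)) ->
     (forall N : submodClosed M,
        (exists2 x : M, x \in N & x != 0) -> ~ faithful (quotmod N)) ->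
     exists (a b c : nat) (chi : int),
       [/\ module_length (quotmod (@jacobson_smul R M)) a,
           module_length (submod (@socle R M)) b,
           bimodule_length (@ring_socle R) c,
           euler_characteristic (socle_graph R) chi &
           a%:Z + b%:Z <= c%:Z + chi]).
Proof.
split=> [k_closed|prod M Mf Msub Mquot]; last first.
  exact: (faithful_length_bound k_infinite R_findim k_central k_socle prod Mf).
apply: wedderburn => // c r; apply/jacquot_piP.
by rewrite !rmorphM /= k_central.
Qed.
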